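(* Let $n \geq 2$ be an integer. (i) Let $f,g \in \mathbb{Z}[X]$ be polynomials of degree $n$ and nonzero discriminant. Then $f$ and $g$ are Hermite equivalent if and only if there is a ring isomorphism between their invariant orders $R_f$ and $R_g$ under which the $(n-1)$-st powers $I_f^{n-1}$ and $I_g^{n-1}$ of their invariant ideals belong to the same ideal class. (ii) Let $f,g \in \mathbb{Z}[X]$ be monic polynomials of degree $n$ and nonzero discriminant. Then $f$ and $g$ are Hermite equivalent if and only if their invariant orders $R_f$ and $R_g$ are isomorphic as rings. (iii) If two polynomials $f,g \in \mathbb{Z}[X]$ of degree $n$ are $\mathrm{GL}_2(\mathbb{Z})$-equivalent, then they are Hermite equivalent. In particular, if $f$ and $g$ are monic and $\mathbb{Z}$-equivalent, then they are Hermite equivalent.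
   Context: Let $f(X)=f_0X^n+f_1X^{n-1}+\cdots+f_n=f_0\prod_{i=1}^n(X-\alpha_i)\in\mathbb{Z}[X]$ have degree $n$ ($f_0\neq 0$, $\alpha_i\in\mathbb{C}$). Its discriminant is $D(f)=f_0^{2n-2}\prod_{1\le i<j\le n}(\alpha_i-\alpha_j)^2$. Hermite equivalence: put $[f](X_1,\ldots,X_n)=f_0^{n-1}\prod_{i=1}^n(\alpha_i^{n-1}X_1+\alpha_i^{n-2}X_2+\cdots+X_n)$. Polynomials $f,g\in\mathbb{Z}[X]$ of degree $n$ are Hermite equivalent if there is $U\in\mathrm{GL}_n(\mathbb{Z})$ with $[g](U\underline{X})=\pm[f](\underline{X})$ for one choice of sign, where $\underline{X}=(X_1,\ldots,X_n)^T$. $\mathrm{GL}_2(\mathbb{Z})$-equivalence: $f,g\in\mathbb{Z}[X]$ of degree $n$ are $\mathrm{GL}_2(\mathbb{Z})$-equivalent if $g(X)=\pm(cX+d)^nf\left(\frac{aX+b}{cX+d}\right)$ for some $\begin{pmatrix}a&b\\c&d\end{pmatrix}\in\mathrm{GL}_2(\mathbb{Z})$ and some sign. $\mathbb{Z}$-equivalence: monic $f,g\in\mathbb{Z}[X]$ of degree $n$ are $\mathbb{Z}$-equivalent if $g(X)=\varepsilon^nf(\varepsilon X+a)$ for some $\varepsilon\in\{\pm1\}$, $a\in\mathbb{Z}$. Invariant order and ideal: let $f$ have degree $n\ge 2$ and nonzero discriminant, let $K_f=\mathbb{Q}[X]/(f)$ and let $\alpha$ be the residue class of $X$ in $K_f$.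 The invariant order $R_f\subset K_f$ is the ring with $\mathbb{Z}$-basis $1,\ f_0\alpha,\ f_0\alpha^2+f_1\alpha,\ \ldots,\ f_0\alpha^{n-1}+f_1\alpha^{n-2}+\cdots+f_{n-2}\alpha$. The invariant ideal $I_f$ is the fractional $R_f$-ideal generated by $1$ and $\alpha$. A ring isomorphism $R_f\to R_g$ extends uniquely to a $\mathbb{Q}$-algebra isomorphism $\varphi:K_f\to K_g$; fractional ideals $I$ of $R_f$ and $J$ of $R_g$ (not necessarily invertible) belong to the same ideal class under it if $\varphi(I)=\kappa J$ for some $\kappa\in K_g^\times$. *)

(* Defs.v *)
From HB Require Import structures.
From mathcomp Require Import all_boot all_order all_algebra all_field.
From mathcomp Require Import fraction qpoly mpoly.

Set Implicit Arguments.
Unset Strict Implicit.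
Unset Printing Implicit Defensive.

Import GRing.Theory.
Local Open Scope ring_scope.

Definition deg (f : {poly int}) : nat := (size f).-1.

(* f_k, the coefficient of X^(n-k) where n is the degree; only used
   for k <= n (beyond that the truncated subtraction would give f_n again). *)
Definition dcoef (f : {poly int}) (k : nat) : int := f`_(deg f - k).

(* The complex roots alpha_1, ..., alpha_n of f, with multiplicity, in the
   (arbitrary) order fixed by the library. Being algebraic, they live in algC. *)
Definition croots (f : {poly int}) : seq algC :=
  sval (closed_field_poly_normal (map_poly intr f : {poly algC})).

Definition disc (f : {poly int}) : algC :=
  (lead_coef f)%:~R ^+ (2 * deg f - 2) *
  \prod_(i < deg f) \prod_(j < deg f | (i < j)%N)
    ((croots f)`_i - (croots f)`_j) ^+ 2.

(* [f](X_1, ..., X_n); the variables are numbered from 0 here, so X_(j+1) is 'X_j. *)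
Definition hermite_form (n : nat) (f : {poly int}) : {mpoly algC[n]} :=
  (lead_coef f)%:~R ^+ n.-1 *:
  \prod_(a <- croots f) \sum_(j < n) a ^+ (n.-1 - j) *: 'X_j.

Definition linear_subst (n : nat) (U : 'M[int]_n) (p : {mpoly algC[n]}) :
    {mpoly algC[n]} :=
  p \mPo [tuple \sum_(j < n) (U i j)%:~R *: 'X_j | i < n].

Definition hermite_equiv (n : nat) (f g : {poly int}) : Prop :=
  exists2 U : 'M[int]_n, U \in unitmx &
    linear_subst U (hermite_form n g) = hermite_form n f \/
    linear_subst U (hermite_form n g) = - hermite_form n f.

(* (cX + d)^n f((aX + b)/(cX + d)), computed in the field of fractions of Z[X];
   cX + d is nonzero whenever A = (a, b; c, d) is in GL_2(Z). *)
Definition moebius (n : nat) (A : 'M[int]_2) (f : {poly int}) :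
    {fraction {poly int}} :=
  let num := tofrac (A 0 0 *: 'X + (A 0 1)%:P) in
  let den := tofrac (A 1 0 *: 'X + (A 1 1)%:P) in
  den ^+ n * (map_poly intr f).[num / den].

Definition GL2_equiv (n : nat) (f g : {poly int}) : Prop :=
  exists2 A : 'M[int]_2, A \in unitmx &
    tofrac g = moebius n A f \/ tofrac g = - moebius n A f.

Definition Z_equiv (n : nat) (f g : {poly int}) : Prop :=
  exists eps a : int, (eps = 1 \/ eps = -1) /\
    g = eps ^+ n *: (f \Po (eps *: 'X + a%:P)).

(* K_f = Q[X]/(f). The quotient {poly %/ h} is only meaningful for monic h of
   positive degree, so f is divided by its leading coefficient, which does not
   change the ideal (f) of Q[X]. *)
Definition qmonic (f : {poly int}) : {poly rat} :=
  (lead_coef f)%:~R^-1 *: map_poly intr f.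

Definition Kalg (f : {poly int}) : Type := {poly %/ qmonic f}.

HB.instance Definition _ (f : {poly int}) :=
  GRing.ComUnitAlgebra.on (Kalg f).
HB.instance Definition _ (f : {poly int}) := Vector.on (Kalg f).

Definition alpha (f : {poly int}) : Kalg f := 'qX.

Definition omega (f : {poly int}) (i : nat) : Kalg f :=
  \sum_(k < i) alpha f ^+ (i - k) *~ dcoef f k.

Definition order_basis (f : {poly int}) : (deg f).-1.+1.-tuple (Kalg f) :=
  [tuple of 1 :: [tuple omega f i.+1 | i < (deg f).-1]].

Definition in_order (f : {poly int}) : {pred Kalg f} :=
  fun x => dec_Qint_span (order_basis f) x.
Arguments in_order : clear implicits.

Implicit Type f : {poly int}.

Lemma in_orderP (f : {poly int}) (x : Kalg f) :
  reflect (inIntSpan (order_basis f) x) (x \in in_order f).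
Proof. exact: sumboolP. Qed.

Lemma in_order_one f : 1 \in in_order f.
Proof.
apply/in_orderP; exists [ffun i => (i == ord0)%:Z].
rewrite (bigD1 ord0) //= big1 => [|i /negPf ni0]; last first.
  by rewrite ffunE ni0 mulr0z.
by rewrite ffunE eqxx addr0 mulr1z.
Qed.

Lemma in_order_sub f : {in in_order f &, forall x y, x - y \in in_order f}.
Proof.
move=> x y /in_orderP[a ->] /in_orderP[b ->]; apply/in_orderP.
exists [ffun i => a i - b i]; rewrite -sumrB; apply: eq_bigr => i _.
by rewrite ffunE mulrzBr.
Qed.

Lemma in_order_zmod f : zmod_closed (in_order f).
Proof.
split; last exact: in_order_sub.
by rewrite -(subrr 1) in_order_sub ?in_order_one.
Qed.

HB.instance Definition _ f := GRing.isZmodClosed.Build (Kalg f) (in_order f)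
  (in_order_zmod f).

Lemma in_order_omega f i : (i < (deg f).-1)%N -> omega f i.+1 \in in_order f.
Proof.
move=> ltif; apply/in_orderP.
pose k : 'I_(deg f).-1.+1 := lift ord0 (Ordinal ltif).
exists [ffun j => (j == k)%:Z].
rewrite (bigD1 k) //= big1 => [|j /negPf njk]; last first.
  by rewrite ffunE njk mulr0z.
rewrite ffunE eqxx addr0 mulr1z.
by rewrite (nth_map (Ordinal ltif)) ?size_enum_ord // nth_enum_ord.
Qed.

Lemma omegaS f i : omega f i.+1 = alpha f * (omega f i + (dcoef f i)%:~R).
Proof.
rewrite /omega big_ord_recr /= subSnn expr1 mulrDr mulrzr; congr (_ + _).
rewrite big_distrr; apply: eq_bigr => k _ /=.
by rewrite subSn 1?ltnW // exprS mulrzAr.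
Qed.

Lemma size_qmonic f : f != 0 -> size (qmonic f) = size f.
Proof.
move=> f0; rewrite /qmonic size_scale ?invr_eq0 ?intr_eq0 ?lead_coef_eq0 //.
by rewrite size_map_inj_poly //; apply: intr_inj.
Qed.

Lemma mk_qmonic f : (1 < size f)%N -> mk_monic (qmonic f) = qmonic f.
Proof.
move=> sf; have f0: f != 0 by rewrite -size_poly_gt0 ltnW.
rewrite /mk_monic size_qmonic // sf monicE lead_coefZ.
rewrite lead_coef_map_inj //; last exact: intr_inj.
by rewrite mulVf ?eqxx // intr_eq0 lead_coef_eq0.
Qed.

Lemma alpha_root f : (1 < size f)%N ->
  \sum_(i < (deg f).+1) alpha f ^+ (deg f - i) *~ dcoef f i = 0.
Proof.
move=> sf; have f0: f != 0 by rewrite -size_poly_gt0 ltnW.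
have sfE: size f = (deg f).+1 by rewrite /deg prednK // ltnW.
transitivity (in_qpoly (qmonic f) (map_poly intr f)).
  rewrite -[map_poly _ _]coefK size_map_inj_poly //; last exact: intr_inj.
  rewrite poly_def sfE (reindex_inj rev_ord_inj) /= raddf_sum.
  apply: eq_bigr => i _ /=.
  have lei: (i <= deg f)%N by rewrite -ltnS.
  rewrite subSS /dcoef (subKn lei).
  rewrite coef_map /= linearZ /= rmorphXn /= -scaler_int.
  by congr (_ *: _); rewrite intz.
apply/val_inj => /=.
rewrite mk_qmonic //.
have -> : map_poly intr f = (lead_coef f)%:~R *: qmonic f :> {poly rat}.
  by rewrite scalerA mulfV ?scale1r // intr_eq0 lead_coef_eq0.
have mf : qmonic f \is monic by rewrite -mk_qmonic // monic_mk_monic.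
by rewrite Pdiv.RingMonic.rmodpZ // Pdiv.Ring.rmodpp ?scaler0 // /GRing.comm mulrC.
Qed.

Lemma omega_deg f : (1 < size f)%N -> omega f (deg f) = - (dcoef f (deg f))%:~R.
Proof.
move=> sf; apply/eqP; rewrite -addr_eq0 -(alpha_root sf) big_ord_recr /=.
by rewrite subnn.
Qed.

Lemma in_order_omega_le f i :
  (1 < size f)%N -> (i <= deg f)%N -> omega f i \in in_order f.
Proof.
move=> sf; case: i => [|i] lei; first by rewrite /omega big_ord0 rpred0.
move: lei; rewrite leq_eqVlt => /orP[/eqP ->|lei]; last first.
  by apply: in_order_omega; case: (deg f) lei.
by rewrite omega_deg // rpredN rpredMz ?in_order_one.
Qed.

(* From omega_(i+1) = alpha (omega_i + f_i) one gets
   omega_(i+1) omega_j = omega_i omega_(j+1) + f_i omega_(j+1) - f_j omega_(i+1). *)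
Lemma in_order_omegaM f i j : (1 < size f)%N -> (i <= deg f)%N ->
  (j <= deg f)%N -> omega f i * omega f j \in in_order f.
Proof.
move=> sf; elim: i j => [|i IHi] j lei lej.
  by rewrite /omega big_ord0 mul0r rpred0.
have [->|nej] := eqVneq j (deg f).
  by rewrite omega_deg // mulrN mulrzr rpredN rpredMz ?in_order_omega_le.
have ltj: (j < deg f)%N by rewrite ltn_neqAle nej.
have ->: omega f i.+1 * omega f j = omega f i * omega f j.+1
    + omega f j.+1 *~ dcoef f i - omega f i.+1 *~ dcoef f j.
  rewrite -(mulrzr _ (dcoef f i)) -(mulrzr _ (dcoef f j)) !omegaS.
  by rewrite [omega f i * _]mulrC -mulrDr [_ * (omega f j + _) * _]mulrAC
    -mulrBr addrK.
by rewrite rpredB ?rpredD ?rpredMz ?in_order_omega_le ?IHi // ltnW.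
Qed.

Lemma in_order_subring f : subring_closed (in_order f).
Proof.
split; [exact: in_order_one | exact: in_order_sub |].
have basis_nth (k : 'I_(deg f).-1.+1) : (order_basis f)`_k = 1 \/
  exists2 m, ((1 < size f) && (m <= deg f))%N & (order_basis f)`_k = omega f m.
  case: (unliftP ord0 k) => [j ->|->]; [right | by left].
  exists j.+1; last first.
    by rewrite lift0 /= (nth_map j) ?size_enum_ord // nth_enum_ord.
  case: j; rewrite /deg; case: (size f) => [|[|m]] //= j ltj.
  exact: leq_trans ltj (leqnSn m).
move=> x y /in_orderP[a ->] /in_orderP[b ->].
rewrite big_distrl rpred_sum //= => i _; rewrite big_distrr rpred_sum //= => j _.
rewrite mulrzAl mulrzAr !rpredMz //.
case: (basis_nth i) => [->|[m /andP[sf lem] ->]];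
  case: (basis_nth j) => [->|[l /andP[sf' lel] ->]];
  rewrite ?mul1r ?mulr1 ?in_order_one ?in_order_omega_le ?in_order_omegaM //.
Qed.

HB.instance Definition _ f := GRing.isSubringClosed.Build (Kalg f) (in_order f)
  (in_order_subring f).

Record invariant_order (f : {poly int}) : predArgType :=
  InvariantOrder { order_val :> Kalg f; _ : order_val \in in_order f }.

HB.instance Definition _ f := [isSub for @order_val f].
HB.instance Definition _ f := [Choice of invariant_order f by <:].
HB.instance Definition _ f :=
  [SubChoice_isSubComNzRing of invariant_order f by <:].

Definition invariant_ideal (f : {poly int}) (x : Kalg f) : Prop :=
  exists a b : invariant_order f, x = \val a * 1 + \val b * alpha f.
Arguments invariant_ideal : clear implicits.

Definition ideal_mul (K : nzRingType) (I J : K -> Prop) (x : K) : Prop :=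
  exists s : seq (K * K),
    (forall p, p \in s -> I p.1 /\ J p.2) /\ x = \sum_(p <- s) p.1 * p.2.

Fixpoint ideal_exp (f : {poly int}) (I : Kalg f -> Prop) (m : nat) :
    Kalg f -> Prop :=
  if m is m'.+1 then ideal_mul I (ideal_exp I m')
  else fun x => x \in in_order f.

(* Phi is the unique extension of phi to a Q-algebra isomorphism K_f -> K_g;
   the last clause is Phi(I) = kappa J. *)
Definition same_ideal_class (f g : {poly int})
    (phi : invariant_order f -> invariant_order g)
    (I : Kalg f -> Prop) (J : Kalg g -> Prop) : Prop :=
  exists Phi : {lrmorphism Kalg f -> Kalg g},
    [/\ bijective Phi,
        forall x : invariant_order f, Phi (\val x) = \val (phi x)
      & exists2 kappa : Kalg g, kappa \is a GRing.unit &
          forall y : Kalg g,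
            (exists2 x, I x & y = Phi x) <-> (exists2 z, J z & y = kappa * z)].

(* Main.v *)
Require Import Defs.
From HB Require Import structures.
From mathcomp Require Import all_boot all_order all_algebra all_field.
From mathcomp Require Import fraction qpoly mpoly.
From mathcomp Require Import perm ring.

Set Implicit Arguments.
Unset Strict Implicit.
Unset Printing Implicit Defensive.

Import GRing.Theory Num.Theory.
Local Open Scope ring_scope.

Implicit Types f g : {poly int}.

(** Write a_1, ..., a_n for the roots of f and b_1, ..., b_n for those of g.
    Hermite equivalence and the isomorphism of invariant orders are both compared
    with one condition on the roots ([root_match]): there are U in GL_n(Z), a
    permutation s and nonzero scalars k_i with

      (b_i^(n-1), ..., b_i, 1) U = k_i (a_(s i)^(n-1), ..., a_(s i), 1),

    together with g_0^(n-1) prod k_i = +- f_0^(n-1).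

    Hermite equivalence gives this condition because a Hermite form is a product
    of n linear forms that are linearly independent when the roots are distinct,
    and in independent coordinates a product of linear forms determines its
    factors up to order and scaling ([match_of_hermite], [monomial_of_prod]).
    The converse is a direct substitution ([hermite_of_match]).

    The last two columns of the condition give k_i = c(b_i) and
    k_i a_(s i) = e(b_i) with integer polynomials c and e. So gamma = c(beta) is
    a unit of K_g, theta = e(beta) / gamma is a root of f in K_g, and
    alpha |-> theta is a Q-algebra morphism Phi : K_f -> K_g; the inverse of U
    gives its inverse ([match_scalar], [match_lift], [root_match_sym]). As U is
    unimodular, gamma Phi(M_f) = M_g where M_f = Z<1, alpha, ..., alpha^(n-1)>;
    and M_f is the ideal power I_f^(n-1) ([ideal_expE]).

    It remains to see that Phi(R_f) = R_g. When f is primitive, R_f is the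
    multiplier ring of M_f: multiplying x by alpha^(n-1) and dividing by f, the
    integral quotient lists the coordinates of x on the basis of R_f
    ([order_of_powers]). In general, with c the content of f, the multiplier ring
    is E_f = Z<1, omega_1 / c, ...> and R_f = Z + c E_f. Here Phi(E_f) = E_g is
    clear, and the contents of f and g agree up to sign because the index of E_f
    relative to M_f is (f_0 / c)^(n-1), while that index is transported by Phi up
    to the norm of gamma ([content_eq], [order_map]).

    Conversely, if Phi(R_f) = R_g and Phi(M_f) = kappa M_g, the second equation
    gives U, and comparing the indices of the orders in these modules gives
    f_0^(n-1) N(kappa) = +- g_0^(n-1), which is the condition on the leading
    coefficients ([hermite_of_iso]).

    For monic f one has M_f = R_f, so every ring isomorphism of the orders
    already respects the ideal classes ([monic_same_class]). For
    GL_2(Z)-equivalent f and g the roots correspond under a Moebius map, and U is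
    the (n-1)-st symmetric power of its matrix ([hermite_of_GL2]). *)

(** * Complex roots *)

Notation cpoly f := (map_poly intr f : {poly algC}).
Definition croot (f : {poly int}) (i : nat) : algC := (croots f)`_i.
Definition lcC (f : {poly int}) : algC := (lead_coef f)%:~R.

Lemma lcC_neq0 (f : {poly int}) : f != 0 -> lcC f != 0.
Proof. by move=> f0; rewrite intr_eq0 lead_coef_eq0. Qed.

Lemma size_neq0 (f : {poly int}) n : size f = n.+1 -> f != 0.
Proof. by move=> sf; rewrite -size_poly_gt0 sf. Qed.

Lemma croots_prod (f : {poly int}) :
  cpoly f = lcC f *: \prod_(z <- croots f) ('X - z%:P).
Proof.
rewrite /croots; case: closed_field_poly_normal => r /= Dr.
rewrite [LHS]Dr; congr (_ *: _).
by rewrite lead_coef_map_inj //; apply: intr_inj.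
Qed.

Lemma size_croots (f : {poly int}) n : size f = n.+1 -> size (croots f) = n.
Proof.
move=> sf; have f0 := size_neq0 sf.
have: size (cpoly f) = n.+1 by rewrite size_map_inj_poly //; exact: intr_inj.
by rewrite croots_prod size_scale ?lcC_neq0 // size_prod_XsubC => -[].
Qed.

Lemma mem_croots (f : {poly int}) a : f != 0 ->
  (a \in croots f) = root (cpoly f) a.
Proof. by move=> f0; rewrite croots_prod rootZ ?lcC_neq0 // root_prod_XsubC.
  Qed.

Lemma root_croot (f : {poly int}) n (i : 'I_n) : size f = n.+1 ->
  root (cpoly f) (croot f i).
Proof.
move=> sf; rewrite -mem_croots ?(size_neq0 sf) //.
by rewrite mem_nth // (size_croots sf).
Qed.

Lemma croot_inj (f : {poly int}) n : size f = n.+1 -> disc f != 0 ->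
  injective (fun i : 'I_n => croot f i).
Proof.
move=> sf; have df : deg f = n by rewrite /deg sf.
rewrite /disc df mulf_eq0 negb_or => /andP[_].
have lt_neq (i j : 'I_n) : (i < j)%N ->
    \prod_(i < n) \prod_(j < n | (i < j)%N) (croot f i - croot f j) ^+ 2 != 0 ->
    croot f i != croot f j.
  move=> ltij /prodf_neq0/(_ i isT)/prodf_neq0/(_ j ltij).
  by rewrite expf_eq0 subr_eq0.
move=> nz i j Eij; apply/val_inj; case: (ltngtP i j) => // ltij.
  by have := lt_neq _ _ ltij nz; rewrite Eij eqxx.
by have := lt_neq _ _ ltij nz; rewrite Eij eqxx.
Qed.

(** * Hermite forms and matching of roots *)

(** If a row of P had two nonzero entries, there would be a vector y in the kernel
    of that row with no zero coordinate: the left-hand product vanishes at y and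
    the right-hand one does not. *)
Lemma monomial_of_prod (F : numFieldType) n (P : 'M[F]_n) (c : F) :
  P \in unitmx -> c != 0 ->
  (forall y : 'cV[F]_n, \prod_i (P *m y) i 0 = c * \prod_i y i 0) ->
  exists (s : 'S_n) (k : 'I_n -> F),
    forall i j, P i j = if j == s i then k i else 0.
Proof.
move=> uP c0 HP.
have row_uniq i a b : P i a != 0 -> P i b != 0 -> a = b.
  move=> Pa Pb; apply/eqP/negPn/negP => neab.
  (* y t has coordinate t at b, 1 away from a and b, and the coordinate at a that
     puts it in the kernel of row i. *)
  pose T := \sum_(j | (j != a) && (j != b)) P i j.
  pose y (t : F) := \col_j (if j == a then - (P i b * t + T) / P i a
                        else if j == b then t else 1) : 'cV[F]_n.
  have Py0 t : (P *m y t) i 0 = 0.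
    rewrite mxE (bigD1 a) //= mxE eqxx (bigD1 b) /=; last by rewrite eq_sym.
    rewrite mxE eqxx eq_sym (negPf neab).
    rewrite (eq_bigr (fun j => P i j)) -/T => [|j /andP[/negPf nja /negPf njb]].
      by rewrite mulrC divfK // addNr.
    by rewrite mxE nja njb mulr1.
  have yt0 (t : F) : t != 0 -> P i b * t + T = 0.
    move=> t0; have := HP (y t); rewrite (bigD1 i) //= Py0 mul0r => /esym/eqP.
    rewrite mulf_eq0 (negPf c0) => /prodf_eq0[] /= j _.
    rewrite mxE; case: (j == a).
      2: by case: (j == b); [rewrite (negPf t0) | rewrite oner_eq0].
    by rewrite mulf_eq0 invr_eq0 (negPf Pa) orbF oppr_eq0 => /eqP.
  (* The equation P i b * t + T = 0 has at most one solution t, yet it holds for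
     t = 1 and for t = 2. *)
  have := yt0 1 (oner_neq0 _); have := yt0 2 _.
  rewrite pnatr_eq0 mulr1 mulr_natr mulr2n -addrA => /(_ isT) + h.
  by rewrite h addr0 => /eqP; rewrite (negPf Pb).
have row_ex i : exists j, P i j != 0.
  apply/existsP; apply: contraLR uP; rewrite negb_exists => /forallP Pi0.
  rewrite unitmxE unitfE negbK (expand_det_row _ i) big1 // => j _.
  by have:= Pi0 j; rewrite negbK => /eqP->; rewrite mul0r.
pose s i := xchoose (row_ex i); have Ps i : P i (s i) != 0 :=
  xchooseP (row_ex i).
have PE i j : P i j = if j == s i then P i (s i) else 0.
  have [->//|nej] := eqVneq j; apply/eqP; apply: contraNT nej => Pij.
  by apply/eqP/(row_uniq i).
have sI : injective s.
  move=> i j Esij; apply/eqP; apply/negPn/negP => neij.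
  (* Two rows supported on the same column would be linearly dependent. *)
  pose v : 'rV[F]_n := P j (s j) *: delta_mx 0 i - P i (s i) *: delta_mx 0 j.
  have vP : v *m P = 0.
    rewrite mulmxBl -!scalemxAl -!rowE; apply/rowP => k.
    rewrite !mxE (PE i k) (PE j k) Esij; case: eqP => _;
      last by rewrite !mulr0 subrr.
    by rewrite mulrC subrr.
  have /(congr1 (mulmx^~ (invmx P))) := vP; rewrite mulmxK // mul0mx.
  move/rowP/(_ i); rewrite !mxE !eqxx (negPf neij) mulr0 mulr1 subr0 => /eqP.
  by rewrite (negPf (Ps j)).
exists (perm sI), (fun i => P i (s i)) => i j; rewrite permE; exact: PE.
Qed.

Section UpToSign.
Variable R : idomainType.
Implicit Types x y z : R.
Definition pm_eq x y : Prop := x = y \/ x = - y.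
Lemma pm_refl x : pm_eq x x. Proof. by left. Qed.
Lemma pm_sym x y : pm_eq x y -> pm_eq y x.
Proof. by case=> ->; [left | right; rewrite opprK]. Qed.
Lemma pm_trans y x z : pm_eq x y -> pm_eq y z -> pm_eq x z.
Proof.
by case=> ->; case=> ->; rewrite ?opprK; [left | right | right | left].
Qed.
Lemma pm_mul x y x' y' : pm_eq x y -> pm_eq x' y' -> pm_eq (x * x') (y * y').
Proof.
case=> ->; case=> ->; rewrite ?mulrN ?mulNr ?opprK;
  by [left | right | right | left].
Qed.
Lemma pm_mulI z x y : z != 0 -> pm_eq (z * x) (z * y) -> pm_eq x y.
Proof.
by move=> z0; case=> [|/esym]; rewrite -?mulrN => /(mulfI z0);
  [left | move=> <-; right; rewrite ?opprK].
Qed.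
End UpToSign.

Definition root_form n (a : algC) : {mpoly algC[n]} :=
  \sum_(j < n) a ^+ (n.-1 - j) *: 'X_j.

Lemma hermite_formE n (f : {poly int}) :
  hermite_form n f = lcC f ^+ n.-1 *: \prod_(a <- croots f) root_form n a.
Proof. by []. Qed.

Lemma prod_croots (R : comPzRingType) n (f : {poly int}) (F : algC -> R) :
  size f = n.+1 -> \prod_(a <- croots f) F a = \prod_(i < n) F (croot f i).
Proof. by move=> /size_croots sf; rewrite (big_nth 0) sf big_mkord. Qed.

Lemma linear_subst_root_form n (U : 'M[int]_n) (k a b : algC) :
  (forall j : 'I_n, \sum_(l < n) a ^+ (n.-1 - l) * (U l j)%:~R = k * b ^+ (n.-1
    - j)) ->
  linear_subst U (root_form n a) = k *: root_form n b.
Proof.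
move=> Uab; rewrite /linear_subst /root_form raddf_sum /=.
transitivity (\sum_(l < n) \sum_(j < n)
                (a ^+ (n.-1 - l) * (U l j)%:~R) *: 'X_j : {mpoly algC[n]}).
  apply: eq_bigr => l _; rewrite comp_mpolyZ comp_mpolyXU -tnth_nth
    tnth_mktuple.
  by rewrite scaler_sumr; apply: eq_bigr => j _; rewrite scalerA.
rewrite exchange_big scaler_sumr; apply: eq_bigr => j _ /=.
by rewrite -scaler_suml Uab scalerA.
Qed.

(** Row i says that U turns the linear form of the i-th root of g into k_i times the
    linear form of the (s i)-th root of f. *)
Definition root_match n (f g : {poly int}) (U : 'M[int]_n) (s : 'S_n)
    (k : 'I_n -> algC) : Prop :=
  forall i j : 'I_n, \sum_(l < n) croot g i ^+ (n.-1 - l) * (U l j)%:~R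
              = k i * croot f (s i) ^+ (n.-1 - j).

Lemma linear_subst_prod n (U : 'M[int]_n) (c : algC) (I : Type) (r : seq I)
    (F : I -> {mpoly algC[n]}) :
  linear_subst U (c *: \prod_(i <- r) F i)
  = c *: \prod_(i <- r) linear_subst U (F i).
Proof. by rewrite /linear_subst comp_mpolyZ rmorph_prod. Qed.

Lemma hermite_of_match n (f g : {poly int}) U (s : 'S_n) k : size f = n.+1 ->
  size g = n.+1 ->
  U \in unitmx -> root_match f g U s k ->
  pm_eq (lcC g ^+ n.-1 * \prod_i k i) (lcC f ^+ n.-1) -> hermite_equiv n f g.
Proof.
move=> sf sg uU m e; exists U => //.
rewrite !hermite_formE linear_subst_prod !(prod_croots _ sf) !(prod_croots _
  sg).
under eq_bigr => i do rewrite (linear_subst_root_form (m i)).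
rewrite scaler_prod scalerA.
have -> : \prod_(i < n) root_form n (croot f (s i)) = \prod_(i < n) root_form n
  (croot f i).
  by rewrite [RHS](reindex_inj (@perm_inj _ s)).
by case: e => ->; [left | right; rewrite scaleNr].
Qed.

Lemma det_vander_neq0 n (f : {poly int}) : size f = n.+1 -> disc f != 0 ->
  \det (Vandermonde n (\row_(i < n) croot f i)) != 0.
Proof.
move=> sf df; rewrite det_Vandermonde.
apply/prodf_neq0 => i _; apply/prodf_neq0 => j ltij.
rewrite !mxE subr_eq0; apply: contraTneq ltij => /(croot_inj sf df)->.
by rewrite ltnn.
Qed.

Definition root_mx n (f : {poly int}) : 'M[algC]_n :=
  \matrix_(i, j) croot f i ^+ (n.-1 - j).

Lemma root_mx_unit n (f : {poly int}) : size f = n.+1 -> disc f != 0 ->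
  root_mx n f \in unitmx.
Proof.
move=> sf df; pose V := Vandermonde n (\row_(i < n) croot f i).
suff -> : root_mx n f = V^T *m perm_mx (perm (@rev_ord_inj n))^-1%g.
  rewrite unitmx_mul unitmx_perm andbT unitmx_tr unitmxE unitfE.
  exact: det_vander_neq0.
rewrite -col_permE; apply/matrixP => i j; rewrite !mxE.
by rewrite permE /= -subn1 subnAC subn1 subnS.
Qed.

Lemma meval_root_form n a (v : 'cV[algC]_n) :
  (root_form n a).@[fun i => v i 0] = \sum_(j < n) a ^+ (n.-1 - j) * v j 0.
Proof.
rewrite /root_form raddf_sum; apply: eq_bigr => j _ /=.
by rewrite mevalZ mevalXU.
Qed.

Lemma meval_subst n (U : 'M[int]_n) p (v : 'cV[algC]_n) :
  (linear_subst U p).@[fun i => v i 0]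
  = p.@[fun i => (map_mx intr U *m v) i 0].
Proof.
rewrite comp_mpoly_meval; apply: meval_eq => i; rewrite tnth_mktuple.
rewrite raddf_sum mxE; apply: eq_bigr => j _ /=.
by rewrite mevalZ mevalXU mxE.
Qed.

(** In the coordinates given by the linear forms of f, which are independent, the
    linear forms of g after substitution have a matrix P whose rows multiply to a
    constant times the product of the coordinates; hence P is monomial. *)
Lemma match_of_hermite n (f g : {poly int}) : size f = n.+1 -> size g = n.+1 ->
  disc f != 0 -> disc g != 0 -> hermite_equiv n f g ->
  exists (U : 'M[int]_n) (s : 'S_n) (k : 'I_n -> algC),
    [/\ U \in unitmx, root_match f g U s k
      & pm_eq (lcC g ^+ n.-1 * \prod_i k i) (lcC f ^+ n.-1)].
Proof.
move=> sf sg df dg [U uU] HU.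
have [e e1 {}HU] : exists2 e : algC, e = 1 \/ e = -1 &
    linear_subst U (hermite_form n g) = e *: hermite_form n f.
  case: HU => ->; [exists 1; rewrite ?scale1r | exists (-1); rewrite ?scaleN1r];
    by auto.
have uf := root_mx_unit sf df; have ug := root_mx_unit sg dg.
pose P := root_mx n g *m map_mx intr U *m invmx (root_mx n f).
pose c := e * lcC f ^+ n.-1 / lcC g ^+ n.-1.
have lf0 := lcC_neq0 (size_neq0 sf); have lg0 := lcC_neq0 (size_neq0 sg).
have e0 : e != 0 by case: e1 => ->; rewrite ?oppr_eq0 oner_eq0.
have c0 : c != 0 by rewrite !mulf_neq0 ?invr_eq0 ?expf_neq0.
have uP : P \in unitmx.
  rewrite !unitmx_mul ug unitmx_inv uf andbT /=.
  rewrite unitmxE det_map_mx unitfE intr_eq0; apply: contraTneq uU => U0.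
  by rewrite unitmxE U0.
have HP (y : 'cV_n) : \prod_i (P *m y) i 0 = c * \prod_i y i 0.
  have := congr1 (meval (fun i => (invmx (root_mx n f) *m y) i 0)) HU.
  rewrite meval_subst mevalZ !hermite_formE !mevalZ.
  rewrite (prod_croots _ sf) (prod_croots _ sg) !rmorph_prod /=.
  under eq_bigr => i _ do rewrite meval_root_form.
  under [in RHS]eq_bigr => i _ do rewrite meval_root_form.
  rewrite mulrA => H; apply: (mulfI (expf_neq0 n.-1 lg0)).
  rewrite mulrA [_ * c]mulrC divfK ?expf_neq0 //.
  transitivity (lcC g ^+ n.-1 * \prod_(i < n) \sum_(j < n) croot g i ^+ (n.-1 -
    j) *
      (map_mx intr U *m (invmx (root_mx n f) *m y)) j 0).
    congr (_ * _); apply: eq_bigr => i _; rewrite /P -!mulmxA mxE.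
    by apply: eq_bigr => j _; rewrite mxE.
  rewrite H; congr (_ * _); apply: eq_bigr => i _.
  rewrite -[y in RHS](mulKVmx uf) [RHS]mxE.
  by apply: eq_bigr => j _; rewrite [root_mx n f i j]mxE.
have [s [k Pk]] := monomial_of_prod uP c0 HP.
exists U, s, k; split=> //.
  move=> i j; have /matrixP/(_ i j) : P *m root_mx n f = root_mx n g *m map_mx
    intr U.
    by rewrite mulmxKV.
  rewrite !mxE (bigD1 (s i)) //= Pk eqxx mxE big1 ?addr0 => [->|l /negPf nl].
    by apply: eq_bigr => l _; rewrite !mxE.
  by rewrite Pk nl mul0r.
(* Evaluate the product identity at the all-ones vector. *)
have Ek : \prod_i k i = c.
  pose y : 'cV[algC]_n := const_mx 1.
  rewrite -[c]mulr1 -[X in c * X](_ : \prod_i y i 0 = 1); last first.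
    by rewrite big1 // => i _; rewrite mxE.
  rewrite -HP; apply: eq_bigr => i _.
  rewrite mxE (bigD1 (s i)) //= Pk eqxx mxE mulr1 big1 ?addr0 // => l /negPf nl.
  by rewrite Pk nl mul0r.
rewrite Ek mulrC divfK ?expf_neq0 //.
by case: e1 => ->; rewrite ?mul1r ?mulN1r; [left | right].
Qed.

(** * Morphisms out of the algebra of f *)

Section Evaluation.
Variables (f : {poly int}) (A : comNzRingType) (iota : {rmorphism rat -> A}).
Variables (theta : A) (sf : (1 < size f)%N).
Hypothesis root_theta : (map_poly intr f).[theta] = 0.

(** The two proofs are arguments of the function, so that a ring morphism structure
    can be attached to it. *)
Definition keval of (1 < size f)%N & (map_poly intr f).[theta] = 0 :=
  fun x : Kalg f => (map_poly iota (val (x : {poly %/ qmonic f}))).[theta].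

Local Notation qev := (keval sf root_theta).

Lemma map_qmonic : map_poly iota (qmonic f) =
  iota (lead_coef f)%:~R^-1 *: map_poly intr f.
Proof.
rewrite /qmonic linearZ /= -map_poly_comp; congr (_ *: _).
by apply: eq_map_poly => a; rewrite /= rmorph_int.
Qed.

Lemma root_map_qmonic : (map_poly iota (qmonic f)).[theta] = 0.
Proof. by rewrite map_qmonic hornerZ root_theta mulr0. Qed.

Lemma keval_in_qpoly p : qev (in_qpoly (qmonic f) p) = (map_poly iota
  p).[theta].
Proof.
have mf : qmonic f \is monic by rewrite -mk_qmonic // monic_mk_monic.
rewrite /keval /= mk_qmonic // [in RHS](Pdiv.RingMonic.rdivp_eq mf p).
by rewrite rmorphD rmorphM hornerD hornerM root_map_qmonic mulr0 add0r.
Qed.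

Fact keval_zmod : zmod_morphism qev.
Proof. by move=> x y; rewrite /keval /= rmorphB hornerD hornerN. Qed.
HB.instance Definition _ :=
  GRing.isZmodMorphism.Build (Kalg f) A qev keval_zmod.

Fact keval_monoid : monoid_morphism qev.
Proof.
split; first by rewrite /keval /= rmorph1 hornerC.
move=> x y; rewrite -[x * y]/(in_qpoly _ (val x * val y)) keval_in_qpoly.
by rewrite rmorphM hornerM.
Qed.
HB.instance Definition _ :=
  GRing.isMonoidMorphism.Build (Kalg f) A qev keval_monoid.

Lemma kevalZ a x : qev (a *: x) = iota a * qev x.
Proof. by rewrite /keval /= linearZ hornerZ. Qed.

Lemma keval_alpha : qev (alpha f) = theta.
Proof. by rewrite keval_in_qpoly map_polyX hornerX. Qed.

End Evaluation.

(** Over the rational algebra structure of A the evaluation is Q-linear as well. *)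
Definition klift f (A : comAlgType rat) (theta : A)
   (sf : (1 < size f)%N) (r : (map_poly intr f).[theta] = 0) :=
  keval (in_alg A) sf r.

Section Lift.
Variables (f : {poly int}) (A : comAlgType rat) (theta : A).
Variables (sf : (1 < size f)%N) (r : (map_poly intr f).[theta] = 0).
HB.instance Definition _ := GRing.RMorphism.on (klift sf r).
Fact klift_scalable : scalable (klift sf r).
Proof. by move=> a x; rewrite /klift kevalZ mulr_algl. Qed.
HB.instance Definition _ :=
  GRing.isScalable.Build rat (Kalg f) A _ (klift sf r) klift_scalable.
End Lift.

Definition kpoly f (x : Kalg f) : {poly rat} := val (x : {poly %/ qmonic f}).

Lemma size_kpoly f (x : Kalg f) : (1 < size f)%N -> (size (kpoly x) < size f)%N.
Proof.
move=> sf; rewrite -[size f]size_qmonic -?size_poly_gt0 ?(ltnW sf) //.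
by rewrite -[in X in (_ < X)%N](mk_qmonic sf) size_mk_monic.
Qed.

Section RootEvaluation.
Variables (n : nat) (f : {poly int}) (sf : size f = n.+1).

Lemma size_gt1 (i : 'I_n) : (1 < size f)%N.
Proof. by rewrite sf ltnS (leq_trans _ (ltn_ord i)). Qed.

Lemma horner_croot (i : 'I_n) : (map_poly intr f).[croot f i] = 0.
Proof. exact/rootP/root_croot. Qed.

(** These n evaluations embed K_f in C^n when the discriminant is nonzero; all
    identities in K_f and all norms are computed there. *)
Definition root_eval (i : 'I_n) : Kalg f -> algC :=
  keval (ratr : {rmorphism rat -> algC}) (size_gt1 i) (horner_croot i).
HB.instance Definition _ i := GRing.RMorphism.on (root_eval i).

Lemma root_eval_alpha i : root_eval i (alpha f) = croot f i.
Proof. exact: keval_alpha. Qed.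

Lemma root_evalZ i a x : root_eval i (a *: x) = ratr a * root_eval i x.
Proof. exact: kevalZ. Qed.

Hypothesis df : disc f != 0.

Lemma root_eval_inj (x y : Kalg f) : (0 < n)%N ->
  (forall i, root_eval i x = root_eval i y) -> x = y.
Proof.
move=> n0 Exy; apply/eqP; rewrite -subr_eq0; apply/eqP.
have {Exy} : forall i, root_eval i (x - y) = 0.
  by move=> i; rewrite rmorphB /= Exy subrr.
move: (x - y) => {x y} x ex0; apply/val_inj/eqP.
rewrite /= -(map_poly_eq0 (ratr : {rmorphism rat -> algC})); apply/eqP.
apply: (@roots_geq_poly_eq0 _ _ [seq croot f i | i : 'I_n]).
- by apply/allP => _ /mapP[i _ ->]; apply/rootP/ex0.
- by rewrite map_inj_uniq ?enum_uniq //; apply: croot_inj.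
rewrite size_map_poly size_map size_enum_ord.
by rewrite -ltnS -sf; apply: size_kpoly; rewrite sf.
Qed.

(** x is coprime to f as soon as it vanishes at no root of f. *)
Lemma root_eval_unit (x : Kalg f) : (0 < n)%N ->
  (forall i, root_eval i x != 0) -> x \is a GRing.unit.
Proof.
move=> n0 ex0; rewrite -[_ \is a _]/(coprimep (mk_monic (qmonic f)) (kpoly x)).
rewrite mk_qmonic ?sf // -(coprimep_map (ratr : {rmorphism rat -> algC})).
apply/Pdiv.ClosedField.coprimepP => a.
rewrite map_qmonic rootZ; last by rewrite fmorph_eq0 invr_eq0 intr_eq0
  lead_coef_eq0 (size_neq0 sf).
rewrite -mem_croots ?(size_neq0 sf) // => /(nthP 0)[i].
rewrite (size_croots sf) => ltin <-.
exact: (ex0 (Ordinal ltin)).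
Qed.
End RootEvaluation.
Arguments root_eval {n f} sf i.

Section LiftEvaluation.
Variables (n : nat) (f g : {poly int}).
Variables (sf : size f = n.+1) (sg : size g = n.+1).

(** A Q-algebra morphism is determined by the image of alpha. *)
Lemma root_eval_lrmorphism (Phi : {lrmorphism Kalg f -> Kalg g}) (i j : 'I_n) :
  root_eval sg i (Phi (alpha f)) = croot f j ->
  forall x, root_eval sg i (Phi x) = root_eval sf j x.
Proof.
move=> Ej x.
have n1 : (1 < size f)%N by apply: size_gt1 sf i.
have -> : x = \sum_(l < size (kpoly x)) (kpoly x)`_l *: alpha f ^+ l.
  transitivity (in_qpoly (qmonic f) (kpoly x) : Kalg f).
    by apply/val_inj; rewrite /= [RHS]in_qpoly_small // size_mk_monic.
  rewrite -[in LHS](coefK (kpoly x)) poly_def raddf_sum.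
  by apply: eq_bigr => l _ /=; rewrite linearZ rmorphXn.
rewrite !rmorph_sum; apply: eq_bigr => l _ /=.
by rewrite linearZ /= !root_evalZ !rmorphXn /= Ej root_eval_alpha.
Qed.

End LiftEvaluation.

(** * Integral spans, the order and the powers of alpha *)

Section ZSpan.
Variable V : zmodType.
Implicit Types (b c : nat -> V) (x y : V).

(** Families are indexed by nat with an explicit length, so that the span of a basis
    does not depend on the way its length is written. *)
Definition zspan n b x : Prop :=
  exists a : nat -> int, x = \sum_(i < n) b i *~ a i.

Lemma zspan_mem n b i : (i < n)%N -> zspan n b (b i).
Proof.
move=> ltin; exists (fun j => (j == i)%:Z).
rewrite (bigD1 (Ordinal ltin)) //= eqxx mulr1z big1 ?addr0 // => j /negPf nj.
by rewrite -val_eqE /= in nj; rewrite nj mulr0z.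
Qed.

Lemma zspan0 n b : zspan n b 0.
Proof. by exists (fun=> 0); rewrite big1 // => i _; rewrite mulr0z. Qed.

Lemma zspanD n b x y : zspan n b x -> zspan n b y -> zspan n b (x + y).
Proof.
move=> [u ->] [v ->]; exists (fun i => u i + v i).
by rewrite -big_split; apply: eq_bigr => i _; rewrite mulrzDr.
Qed.

Lemma zspanMz n b x a : zspan n b x -> zspan n b (x *~ a).
Proof.
move=> [u ->]; exists (fun i => u i * a).
by rewrite mulrz_suml; apply: eq_bigr => i _; rewrite mulrzA.
Qed.

Lemma zspanN n b x : zspan n b x -> zspan n b (- x).
Proof. by move=> /(zspanMz (-1)); rewrite mulrN1z. Qed.

Lemma zspan_sum n b (I : Type) (r : seq I) (P : pred I) (F : I -> V) :
  (forall i, P i -> zspan n b (F i)) -> zspan n b (\sum_(i <- r | P i) F i).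
Proof.
move=> HF; elim/big_ind: _ => //; [exact: zspan0 | exact: zspanD].
Qed.

End ZSpan.

Lemma zspan_map (V W : zmodType) (F : {additive V -> W}) n b x :
  zspan n b x -> zspan n (F \o b) (F x).
Proof.
move=> [u ->]; exists u; rewrite raddf_sum.
by apply: eq_bigr => i _; rewrite raddfMz.
Qed.

Definition alpha_powers f (j : nat) : Kalg f := alpha f ^+ j.
(** For s = 1 these generate R_f; for s the inverse of the content of f they generate
    the order of the primitive part of f, realized inside K_f. *)
Definition order_gen (s : rat) f (i : nat) : Kalg f :=
  if i is j.+1 then s *: omega f i else 1.

Lemma in_order_zspan n f (x : Kalg f) : size f = n.+1 -> (0 < n)%N ->
  x \in in_order f <-> zspan n (order_gen 1 f) x.
Proof.
move=> sf n0; have dn : (deg f).-1.+1 = n by rewrite /deg sf prednK.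
have obE (i : 'I_(deg f).-1.+1) : (order_basis f)`_i = order_gen 1 f i.
  case: i => -[|i] //= lti; rewrite scale1r.
  by rewrite (nth_map (Ordinal (lti : (i < _)%N))) ?size_enum_ord //
    nth_enum_ord.
split=> [/in_orderP[a ->]|[a ->]].
  exists (fun i => a (inord i)); rewrite -dn; apply: eq_bigr => i _.
  by rewrite obE inord_val.
apply/in_orderP; exists [ffun i : 'I_(deg f).-1.+1 => a i]; rewrite -dn;
  apply: eq_bigr => i _.
by rewrite obE ffunE.
Qed.

Lemma horner_alpha f p :
  (map_poly intr p).[alpha f] = in_qpoly (qmonic f) (map_poly intr p) :> Kalg f.
Proof.
rewrite -[p]coefK poly_def !rmorph_sum /= horner_sum.
apply: eq_bigr => i _; rewrite !map_polyZ /= !map_polyXn hornerZ hornerXn.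
by rewrite linearZ rmorphXn /= mulrzl scaler_int.
Qed.

(** Taking c = 1 treats R_f itself; taking for c the content of f and for h its
    primitive part treats the multiplier ring of M. *)
Section OrderAndPowers.
Variables (n : nat) (f h : {poly int}) (c : int).
Hypotheses (sf : size f = n.+1) (n0 : (0 < n)%N) (c0 : c != 0) (fE : f = c *:
  h).
Let s : rat := c%:~R^-1.
Local Notation al := (alpha f).
Local Notation M := (zspan n (alpha_powers f)).
Local Notation O := (zspan n (order_gen s f)).

Let sf1 : (1 < size f)%N. Proof. by rewrite sf. Qed.
Let degf : deg f = n. Proof. by rewrite /deg sf. Qed.
Let dcoefE i : dcoef f i = c * h`_(n - i).
Proof. by rewrite /dcoef degf fE coefZ. Qed.

Let scaleKc (x : Kalg f) a : s *: (x *~ (c * a)) = x *~ a.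
Proof.
by rewrite mulrzA -scalerMzr -[x *~ c]scaler_int scalerA mulVf ?scale1r
  ?intr_eq0.
Qed.

Lemma somegaS i : s *: omega f i.+1 = al * (s *: omega f i + (h`_(n - i))%:~R).
Proof. by rewrite omegaS scalerAr scalerDr dcoefE scaleKc. Qed.

Lemma somega_top : s *: omega f n = - (h`_0)%:~R.
Proof. by rewrite -degf omega_deg // scalerN dcoefE degf scaleKc subnn. Qed.

Lemma somegaE i : s *: omega f i = \sum_(k < i) al ^+ (i - k) *~ h`_(n - k).
Proof.
by rewrite /omega scaler_sumr; apply: eq_bigr => k _; rewrite dcoefE scaleKc.
Qed.

Lemma powers_int a : M a%:~R.
Proof. by apply/zspanMz; rewrite -[1]/(alpha_powers f 0); apply/zspan_mem. Qed.

(** The recurrence omega_i alpha = omega_(i+1) - f_i alpha, divided by c, trades one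
    power of alpha for one index; the index n is harmless since omega_n = - f_n. *)
Lemma somega_pow i j : (i <= n)%N -> (j < n)%N ->
  M (s *: omega f i * al ^+ j).
Proof.
elim: j i => [|j IH] i.
  rewrite leq_eqVlt mulr1 => /orP[/eqP-> _|lti _].
    rewrite somega_top; apply/zspanN/powers_int.
  rewrite somegaE; apply: zspan_sum => k _; apply/zspanMz.
  apply: (zspan_mem (alpha_powers f)); exact: leq_ltn_trans (leq_subr _ _) lti.
rewrite leq_eqVlt => /orP[/eqP-> ltj|lti ltj].
  rewrite somega_top mulNr mulrzl; apply/zspanN/zspanMz.
  exact: (zspan_mem (alpha_powers f)).
have -> : s *: omega f i * al ^+ j.+1 =
    s *: omega f i.+1 * al ^+ j - al ^+ j.+1 *~ h`_(n - i).
  by rewrite somegaS exprS -mulrzl; ring.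
apply: zspanD; first by apply: IH => //; apply: ltnW.
by apply/zspanN/zspanMz/(zspan_mem (alpha_powers f)).
Qed.

Lemma order_mul_powers x y : O x -> M y -> M (x * y).
Proof.
move=> [u ->] [v ->]; rewrite mulr_suml; apply: zspan_sum => i _.
rewrite mulr_sumr; apply: zspan_sum => j _.
rewrite mulrzAl mulrzAr; do 2!apply: zspanMz.
case: i => -[|i] /= lti; first by rewrite mul1r; apply: zspan_mem.
by apply: somega_pow => //; apply: ltnW.
Qed.

Hypothesis hprim : zprimitive h = h.

(** Write x = p(alpha) and x alpha^(n-1) = r(alpha) with p, r integral of degree
    less than n. By Gauss, X^(n-1) p - r = h q with q integral, of degree at most
    n - 2. Above degree n - 1 the remainder r is invisible, and comparing
    coefficients gives p(alpha) = p_0 + sum_k q_k omega_(k+1) / c. *)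
Lemma order_of_powers x : M x -> M (x * al ^+ n.-1) -> O x.
Proof.
move=> [u Dx] [v Dxa].
have sh : size h = n.+1 by rewrite -sf fE size_scale.
pose p : {poly int} := \poly_(i < n) u i.
pose r : {poly int} := \poly_(i < n) v i.
have evp w : (map_poly intr (\poly_(i < n) w i)).[al] = \sum_(i < n)
  alpha_powers f i *~ w i.
  rewrite poly_def rmorph_sum horner_sum; apply: eq_bigr => i _ /=.
  by rewrite map_polyZ map_polyXn hornerZ hornerXn mulrzl.
have [q Dq] : {q | 'X^(n.-1) * p - r = h * q}.
  rewrite -hprim; apply: dvdpP_int; rewrite -dvdp_rat_int.
  have : in_qpoly (qmonic f) (map_poly intr ('X^(n.-1) * p - r)) = 0.
    rewrite -horner_alpha rmorphB rmorphM /= map_polyXn hornerD hornerN hornerM.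
    by rewrite hornerXn !evp -Dx -Dxa mulrC subrr.
  move=> /(congr1 val) /=; rewrite mk_qmonic // => /eqP.
  rewrite -[_ == 0]/(Pdiv.CommonRing.rdvdp _ _) -Pdiv.Idomain.dvdpE.
  apply: dvdp_trans; rewrite /qmonic dvdpZr ?invr_eq0 ?intr_eq0 ?lead_coef_eq0
    ?(size_neq0 sf) //.
  by rewrite fE map_polyZ /= dvdpZr ?intr_eq0.
have sq : (size q <= n.-1)%N.
  have [->|q0] := eqVneq q 0; first by rewrite size_poly0.
  have h0 : h != 0 by rewrite -size_poly_gt0 sh.
  have : (size ('X^(n.-1) * p - r)%R <= n.-1 + n)%N.
    rewrite (leq_trans (size_polyD _ _)) // size_polyN geq_max.
    rewrite (leq_trans (size_poly _ _)) ?leq_addl // andbT.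
    have [->|p0] := eqVneq p 0; first by rewrite mulr0 size_poly0.
    by rewrite size_monicM ?monicXn // size_polyXn /= leq_add2l size_poly.
  by rewrite Dq size_mul // sh addSn /= addnC leq_add2r.
(* The coefficient of p in degree m + 1 is that of X^(n-1) p - r in degree
   n + m. *)
have up m : (m < n.-1)%N -> u m.+1 = \sum_(k < n.-1) q`_k * h`_(n + m - k).
  move=> ltm; have ltm1 : (m.+1 < n)%N by rewrite -ltn_predRL.
  have nm : (n.-1 + m.+1)%N = (n + m)%N by rewrite addnS -addSn prednK.
  have -> : u m.+1 = ('X^(n.-1) * p - r)`_(n + m).
    rewrite coefB -{1}nm coefXnM ltnNge leq_addr addKn !coef_poly ltm1.
    by rewrite ltnNge leq_addr subr0.
  rewrite Dq mulrC coefM (big_ord_widen _ (fun k => q`_k * h`_(n + m - k))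
    (_ : n.-1 <= (n + m).+1)%N).
    rewrite [RHS]big_mkcond; apply: eq_bigr => k _.
    by case: ltnP => // lek; rewrite nth_default ?mul0r // (leq_trans sq).
  by rewrite (leq_trans (leq_pred _)) // -addnS leq_addr.
(* The terms with m > k vanish, their coefficient of h being of index above n. *)
have omE k : (k < n.-1)%N ->
    s *: omega f k.+1 = \sum_(m < n.-1) al ^+ m.+1 *~ h`_(n + m - k).
  move=> ltk; rewrite somegaE (reindex_inj rev_ord_inj) /=.
  rewrite [RHS](eq_bigr (fun m : 'I_n.-1 =>
    if (m < k.+1)%N then al ^+ m.+1 *~ h`_(n + m - k) else 0)).
    rewrite -big_mkcond -(big_ord_widen _ (fun m =>
      al ^+ m.+1 *~ h`_(n + m - k))) //.
    apply: eq_bigr => m _; have lem : (m <= k)%N by rewrite -ltnS.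
    by rewrite subSS subSn ?leq_subr // subKn // subnBA.
  move=> m _; case: ltnP => // ltkm; rewrite nth_default ?mulr0z //.
  by rewrite sh -addnBA ?(ltnW ltkm) // -[n.+1]addn1 leq_add2l subn_gt0.
exists (fun k => if k is j.+1 then q`_j else u 0%N).
rewrite Dx -(prednK n0) !big_ord_recl /=; congr (_ + _).
transitivity (\sum_(m < n.-1) \sum_(k < n.-1) al ^+ m.+1 *~ h`_(n + m - k) *~
  q`_k).
  apply: eq_bigr => m _; rewrite /bump /= add1n up // mulrz_sumr.
  by apply: eq_bigr => k _; rewrite mulrC mulrzA.
rewrite exchange_big; apply: eq_bigr => k _ /=.
by rewrite /bump add1n /= omE // mulrz_suml.
Qed.
End OrderAndPowers.

(** * The (n-1)-st power of the invariant ideal *)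

Section IdealPower.
Variables (n : nat) (f : {poly int}).
Hypotheses (sf : size f = n.+1) (n1 : (1 < n)%N).
Local Notation al := (alpha f).
Local Notation M := (zspan n (alpha_powers f)).
Local Notation I m := (ideal_exp (invariant_ideal f) m).

Lemma in_order_mul_powers x y : x \in in_order f -> M y -> M (x * y).
Proof.
move=> /(in_order_zspan x sf (ltnW n1)) xO.
by apply: (@order_mul_powers n f f 1 sf (ltnW n1)); rewrite ?scale1r.
Qed.

(** Each factor (a + b alpha) uses up one power of alpha, and M is stable under
    R_f. *)
Lemma ideal_exp_sub_powers m j x : (j + m < n)%N -> I m x -> M (x * al ^+ j).
Proof.
elim: m j x => [|m IH] j x ltjm.
  move=> xO; apply: in_order_mul_powers => //;
    apply: (zspan_mem (alpha_powers f)).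
  by rewrite addn0 in ltjm.
case=> s [Hs ->]; rewrite mulr_suml big_seq; apply: zspan_sum => p ps.
have [[a [b ->]] Ip2] := Hs p ps.
have -> : (\val a * 1 + \val b * al) * p.2 * al ^+ j =
    \val a * (p.2 * al ^+ j) + \val b * (p.2 * al ^+ j.+1).
  by rewrite exprS; ring.
apply: zspanD; (apply: in_order_mul_powers; first exact: valP); apply: IH => //.
  by rewrite (leq_trans _ ltjm) // ltnS addnS.
by rewrite addSnnS.
Qed.

Lemma invariant_ideal_gen a b : a \in in_order f -> b \in in_order f ->
  invariant_ideal f (a + b * al).
Proof.
by move=> Oa Ob; exists (InvariantOrder Oa), (InvariantOrder Ob); rewrite mulr1.
Qed.

Lemma powers_ideal_exp m j : (j <= m)%N -> I m (al ^+ j).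
Proof.
have O1 := in_order_one f; have O0 : 0 \in in_order f by apply: rpred0.
elim: m j => [|m IH] j; first by rewrite leqn0 => /eqP->.
case: j => [_|j lej].
  exists [:: (1, 1)]; rewrite big_seq1 mulr1; split=> // _ /[!inE]/eqP->.
  by split; [have := invariant_ideal_gen O1 O0;
    rewrite mul0r addr0 | apply: (IH 0%N)].
exists [:: (al, al ^+ j)]; rewrite big_seq1 exprS; split=> // _ /[!inE]/eqP->.
by split; [have := invariant_ideal_gen O0 O1; rewrite mul1r add0r | apply: IH].
Qed.

(** I_f^(n-1) is generated over R_f by 1, ..., alpha^(n-1), whose integral span is
    already an R_f-module. *)
Lemma ideal_expE x : I n.-1 x <-> M x.
Proof.
split=> [Ix|[u ->]].
  by rewrite -[x]mulr1; apply: (ideal_exp_sub_powers (j := 0) (m := n.-1));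
    rewrite ?ltn_predL ?(ltnW n1).
case: n n1 u => [|[|m]] // _ u; rewrite /=.
have O1 := in_order_one f; have O0 : 0 \in in_order f by apply: rpred0.
(* u_0 is u_0 times 1, and u_j alpha^j is u_j alpha times alpha^(j-1). *)
exists [seq (if (j == 0%N :> nat) then (u j)%:~R else (u j)%:~R * al, al ^+
  j.-1) | j <- iota 0 m.+2].
split=> [p /mapP[j + ->{p}]|].
  rewrite mem_iota /= add0n => ltj; split; last first.
    by apply: powers_ideal_exp; case: j ltj.
  have Ou : (u j)%:~R \in in_order f by apply: rpred_int.
  case: eqP => _; [have := invariant_ideal_gen Ou O0 | have :=
    invariant_ideal_gen O0 Ou].
    by rewrite mul0r addr0.
  by rewrite add0r.
rewrite big_map -[iota 0 m.+2]/(index_iota 0 m.+2) big_mkord.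
apply: eq_bigr => -[[|j] ltj] _ /=; first by rewrite mulrzl.
by rewrite /alpha_powers exprS -mulrA mulrzl.
Qed.
End IdealPower.

(** * Determinants and indices of lattices *)

Section EvaluationMatrix.
Variables (n : nat) (f : {poly int}) (sf : size f = n.+1).
Implicit Types b c : nat -> Kalg f.

(** Up to sign, the determinant of this matrix is the covolume of the lattice spanned
    by b_0, ..., b_(n-1) in C^n; quotients of such determinants are lattice
    indices. *)
Definition eval_mx b : 'M[algC]_n := \matrix_(i, j) root_eval sf i (b j).

Lemma zspan_mx b c : (forall j : 'I_n, zspan n c (b j)) ->
  exists A : 'M[int]_n, (forall j : 'I_n, b j = \sum_(i < n) c i *~ A i j) /\
    eval_mx b = eval_mx c *m map_mx intr A.
Proof.
move=> /fin_all_exists[a Da]; exists (\matrix_(i, j) a j i).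
have bE (j : 'I_n) : b j = \sum_(i < n) c i *~ (\matrix_(i, j) a j i) i j.
  by rewrite Da; apply: eq_bigr => i _; rewrite mxE.
split=> //; apply/matrixP => i j; rewrite !mxE bE rmorph_sum /=.
by apply: eq_bigr => l _; rewrite rmorphMz /= !mxE mulrzr.
Qed.

(** Expressing b on c and c on b gives two integer matrices that are inverse to each
    other because c is a basis. *)
Lemma zspan_unimodular b c : \det (eval_mx c) != 0 ->
  (forall j : 'I_n, zspan n c (b j)) -> (forall j : 'I_n, zspan n b (c j)) ->
  (exists2 A : 'M[int]_n, A \in unitmx &
     forall j : 'I_n, b j = \sum_(i < n) c i *~ A i j) /\
  pm_eq (\det (eval_mx b)) (\det (eval_mx c)).
Proof.
move=> c0 /zspan_mx[A [bE bA]] /zspan_mx[B [_ cB]].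
have AB1 : A *m B = 1%:M.
  have uc : eval_mx c \in unitmx by rewrite unitmxE unitfE.
  have : map_mx intr (A *m B) = map_mx intr 1%:M :> 'M[algC]_n.
    by rewrite map_mx1 map_mxM -[LHS](mulKmx uc) [eval_mx c *m _]mulmxA -bA -cB
      mulVmx.
  by move=> /matrixP eAB; apply/matrixP => i j; have := eAB i j;
    rewrite !mxE => /intr_inj.
have [uA _] := mulmx1_unit AB1; split; first by exists A.
rewrite bA det_mulmx det_map_mx.
have /orP[/eqP->|/eqP->] : (\det A == 1) || (\det A == -1) := uA.
  by rewrite mulr1; left.
by rewrite mulrN1; right.
Qed.

Lemma det_powers : \det (eval_mx (alpha_powers f)) =
  \det (Vandermonde n (\row_(i < n) croot f i)).
Proof.
rewrite -[RHS]det_tr; congr (\det _); apply/matrixP => i j.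
by rewrite !mxE rmorphXn /= root_eval_alpha.
Qed.

Lemma det_powers_neq0 : disc f != 0 -> \det (eval_mx (alpha_powers f)) != 0.
Proof. by rewrite det_powers; exact: det_vander_neq0. Qed.

Lemma det_scale (x : Kalg f) b :
  \det (eval_mx (fun j => x * b j)) = (\prod_i root_eval sf i x) * \det
    (eval_mx b).
Proof.
rewrite -[\prod_i _](_ : \det (diag_mx (\row_i root_eval sf i x)) = _).
  rewrite -det_mulmx; congr (\det _); apply/matrixP => i j.
  by rewrite mul_diag_mx !mxE rmorphM.
by rewrite det_diag; apply: eq_bigr => i _; rewrite mxE.
Qed.

(** The matrix of 1, s omega_1, ..., s omega_(n-1) on the powers of alpha is
    triangular with diagonal 1, s f_0, ..., s f_0. *)
Lemma det_order_gen (s : rat) : (0 < n)%N ->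
  \det (eval_mx (order_gen s f)) =
    (ratr s * lcC f) ^+ n.-1 * \det (eval_mx (alpha_powers f)).
Proof.
move=> n0; have degf : deg f = n by rewrite /deg sf.
pose t (k j : nat) : algC := if j == 0%N then (k == 0%N)%:R
  else if (0 < k <= j)%N then ratr s * (dcoef f (j - k))%:~R else 0.
pose T : 'M[algC]_n := \matrix_(k, j) t k j.
have -> : eval_mx (order_gen s f) = eval_mx (alpha_powers f) *m T.
  apply/matrixP => i j; rewrite !mxE.
  case: j => -[|j] ltj /=.
    rewrite (bigD1 (Ordinal ltj)) //= !mxE /t /= mulr1 big1 ?addr0 // => k.
    by rewrite -val_eqE /= !mxE /= /t => /negPf /= ->; rewrite mulr0.
  rewrite root_evalZ /omega rmorph_sum /= (reindex_inj rev_ord_inj) /=.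
  rewrite mulr_sumr.
  pose F k := if (0 < k <= j.+1)%N then
     ratr s * (croot f i ^+ k * (dcoef f (j.+1 - k))%:~R) else 0.
  rewrite [RHS](eq_bigr (fun k : 'I_n => F k)); last first.
    move=> k _; rewrite !mxE /t /F /= rmorphXn /= root_eval_alpha.
    by case: ifP => _; rewrite ?mulr0 // mulrCA.
  have -> : \sum_(k < n) F k = \sum_(k < n.-1) if (k < j.+1)%N then F k.+1 else
    0.
    case: (n) n0 => // N _; rewrite big_ord_recl /= add0r.
    by apply: eq_bigr => k _; rewrite /bump add1n /F /= ltnS; case: ifP.
  rewrite -big_mkcond -(big_ord_widen _ (fun k => F k.+1));
    last by rewrite ltn_predRL.
  apply: eq_bigr => k _; rewrite /F ltn_ord /=.
  by rewrite rmorphMz rmorphXn /= root_eval_alpha mulrzr !subSS subSn ?leq_subr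
    // subKn // -ltnS.
rewrite det_mulmx mulrC; congr (_ * _); rewrite -det_tr det_trig; last first.
  apply/is_trig_mxP => i j ltij; rewrite !mxE /t.
  case: eqP ltij => [-> | _]; first by case: (nat_of_ord j).
  by rewrite ltnNge => /negPf->; rewrite andbF.
transitivity (\prod_(i < n) t i i); first by apply: eq_bigr => i _;
  rewrite !mxE.
case: (n) n0 => // N _; rewrite big_ord_recl /t /= mul1r.
rewrite -[N in RHS]card_ord -prodr_const; apply: eq_bigr => i _.
by rewrite /= leqnn subnn /dcoef subn0 /lcC lead_coefE.
Qed.
End EvaluationMatrix.

Section DetMorphism.
Variables (n : nat) (f g : {poly int}).
Variables (sf : size f = n.+1) (sg : size g = n.+1).

(** Phi only permutes the complex evaluations, that is, the rows. *)
Lemma det_lrmorphism (Phi : Kalg f -> Kalg g) (s : 'S_n) b :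
  (forall i x, root_eval sg i (Phi x) = root_eval sf (s i) x) ->
  pm_eq (\det (eval_mx sg (Phi \o b))) (\det (eval_mx sf b)).
Proof.
move=> PhiE; have -> : eval_mx sg (Phi \o b) = perm_mx s *m eval_mx sf b.
  by rewrite -row_permE; apply/matrixP => i j; rewrite !mxE PhiE.
rewrite det_mulmx det_perm.
by case: (odd_perm s); rewrite ?mulN1r ?mul1r; [right | left].
Qed.
End DetMorphism.

(** * From isomorphic orders to Hermite equivalence *)

Section IsoToHermite.
Variables (n : nat) (f g : {poly int}).
Hypotheses (sf : size f = n.+1) (sg : size g = n.+1).
Hypotheses (df : disc f != 0) (dg : disc g != 0).

Lemma map_poly_int_horner (A B : comNzRingType) (F : {rmorphism A ->
  B}) (p : {poly int}) x :
  F (map_poly intr p).[x] = (map_poly intr p).[F x].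
Proof.
rewrite -horner_map -map_poly_comp; congr (_.[_]).
by apply: eq_map_poly => a; rewrite /= rmorph_int.
Qed.

Lemma horner_alpha0 : (1 < size f)%N -> (map_poly intr f).[alpha f] = 0.
Proof.
move=> f1; have f0 := size_neq0 sf.
rewrite horner_alpha; have -> : map_poly intr f = (lead_coef f)%:~R *: qmonic f
  :> {poly rat}.
  by rewrite scalerA mulfV ?scale1r // intr_eq0 lead_coef_eq0.
rewrite linearZ /=; apply/val_inj => /=.
by rewrite mk_qmonic // Pdiv.RingMonic.rmodpp ?scaler0 // -mk_qmonic
  ?monic_mk_monic.
Qed.

(** Every evaluation of Phi(alpha) is a root of f, and surjectivity of Phi makes
    distinct evaluations of K_g restrict to distinct evaluations of K_f. *)
Lemma root_perm (Phi : {lrmorphism Kalg f -> Kalg g}) : bijective Phi ->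
  exists s : 'S_n, forall i x, root_eval sg i (Phi x) = root_eval sf (s i) x.
Proof.
case=> Psi _ PhiPsiK.
have ex_root (i : 'I_n) : exists j : 'I_n, croot f j = root_eval sg i (Phi
  (alpha f)).
  have: root_eval sg i (Phi (alpha f)) \in croots f.
    rewrite mem_croots ?(size_neq0 sf) //; apply/rootP.
    rewrite -(map_poly_int_horner (root_eval sg i)) -(map_poly_int_horner Phi).
    by rewrite horner_alpha0 ?rmorph0 // (size_gt1 sf i).
  case/(nthP 0) => j; rewrite (size_croots sf) => ltj <-.
  by exists (Ordinal ltj).
have [s sE] := fin_all_exists ex_root.
have PhiE i x : root_eval sg i (Phi x) = root_eval sf (s i) x by apply:
  root_eval_lrmorphism; rewrite sE.
have sI : injective s.
  move=> i j Eij; apply: (croot_inj sg dg);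
    rewrite -!(root_eval_alpha sg) -(PhiPsiK (alpha g)).
  by rewrite !PhiE Eij.
by exists (perm sI) => i x; rewrite permE.
Qed.

(** Phi(M_f) = kappa M_g gives the integer matrix, with scalars the inverses of the
    evaluations of kappa. The determinants of Phi(M_f) and of Phi(R_f), computed
    on both sides, give f_0^(n-1) N(kappa) = +- g_0^(n-1). *)
Lemma hermite_of_iso (Phi : {lrmorphism Kalg f -> Kalg g}) (kappa : Kalg g) :
  (1 < n)%N -> bijective Phi -> kappa \is a GRing.unit ->
  (forall x, x \in in_order f -> Phi x \in in_order g) ->
  (forall y, y \in in_order g -> exists2 x, x \in in_order f & y = Phi x) ->
  (forall y, (exists2 x, zspan n (alpha_powers f) x & y = Phi x) <->
             (exists2 z, zspan n (alpha_powers g) z & y = kappa * z)) ->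
  hermite_equiv n f g.
Proof.
move=> n1 Phi_bij uk Rfg Rgf Mfg; have n0 := ltnW n1.
have [s PhiE] := root_perm Phi_bij.
pose K := \prod_i root_eval sg i kappa.
have k0 i : root_eval sg i kappa != 0 by rewrite -unitfE rmorph_unit.
have K0 : K != 0 by apply/prodf_neq0.
have Vg0 := det_powers_neq0 sg dg.
have lg0 := lcC_neq0 (size_neq0 sg).
have [|j|j|[A uA EA] detM] := @zspan_unimodular _ _ sg (Phi \o alpha_powers f)
  (fun j => kappa * alpha_powers g j).
- by rewrite det_scale mulf_neq0.
- rewrite /=; have [|z [u ->] ->] := (Mfg (Phi (alpha_powers f j))).1.
    by exists (alpha_powers f j); [exact: zspan_mem|].
  by exists u; rewrite mulr_sumr; apply: eq_bigr => i _; rewrite mulrzAr.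
- have [|x [u ->] ->] := (Mfg (kappa * alpha_powers g j)).2.
    by exists (alpha_powers g j); [exact: zspan_mem|].
  by exists u; rewrite rmorph_sum; apply: eq_bigr => i _; rewrite /= rmorphMz.
have [|j|j|_ detR] := @zspan_unimodular _ _ sg (Phi \o order_gen 1 f)
  (order_gen 1 g).
- rewrite det_order_gen // rmorph1 mul1r mulf_neq0 ?expf_neq0 //.
- apply/(in_order_zspan _ sg n0)/Rfg/(in_order_zspan _ sf n0).
  exact: zspan_mem.
- have [|x xR ->] := Rgf (order_gen 1 g j).
    by apply/(in_order_zspan _ sg n0); apply: zspan_mem.
  by apply: zspan_map; apply/(in_order_zspan _ sf n0).
(* Hermite forms list the powers of a root in decreasing order. *)
pose U : 'M[int]_n := \matrix_(i, j) A (rev_ord i) (rev_ord j).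
have uU : U \in unitmx.
  rewrite (_ : U = perm_mx (perm (@rev_ord_inj n)) *m A *m perm_mx (perm
    (@rev_ord_inj n))^-1%g).
    by rewrite !unitmx_mul !unitmx_perm uA.
  by rewrite -row_permE -col_permE; apply/matrixP => i j; rewrite !mxE !permE.
apply: (@hermite_of_match n f g U s (fun i => (root_eval sg i kappa)^-1)) => //.
  move=> i j; apply: (mulfI (k0 i)); rewrite mulrA mulfV // mul1r.
  have := congr1 (root_eval sg i) (EA (rev_ord j));
    rewrite /= PhiE rmorphXn /= root_eval_alpha.
  have revE (l : 'I_n) : (n.-1 - l)%N = rev_ord l.
    by rewrite /= -subn1 subnAC subn1 subnS.
  rewrite revE => ->; rewrite rmorph_sum mulr_sumr (reindex_inj rev_ord_inj).
  apply: eq_bigr => l _; rewrite revE mxE rev_ordK.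
  by rewrite rmorphMz rmorphM rmorphXn /= root_eval_alpha mulrzr -mulrzAr.
have KV : K * \prod_i (root_eval sg i kappa)^-1 = 1 by rewrite prodfV mulfV.
apply: (pm_mulI K0); rewrite mulrCA KV mulr1; apply: (pm_mulI Vg0).
rewrite ![\det _ * _]mulrC; rewrite det_order_gen // rmorph1 mul1r in detR.
apply: pm_trans (pm_sym detR) _; apply: pm_trans (det_lrmorphism _ PhiE) _.
rewrite det_order_gen // rmorph1 mul1r [K * _]mulrC -mulrA.
rewrite det_scale in detM; apply: pm_mul; first exact: pm_refl.
exact: pm_trans (pm_sym (det_lrmorphism _ PhiE)) detM.
Qed.
End IsoToHermite.

(** * From Hermite equivalence to isomorphic orders *)

Lemma match_neq0 n f g (k : 'I_n -> algC) : f != 0 ->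
  pm_eq (lcC g ^+ n.-1 * \prod_i k i) (lcC f ^+ n.-1) -> forall i, k i != 0.
Proof.
move=> /lcC_neq0 lf0 e i; have : lcC g ^+ n.-1 * \prod_i k i != 0.
  by case: e => ->; rewrite ?oppr_eq0 expf_neq0.
by rewrite mulf_eq0 negb_or => /andP[_ /prodf_neq0/(_ i isT)].
Qed.

(** With this symmetry, each statement on Phi below also serves for its inverse. *)
Lemma root_match_sym n f g U (s : 'S_n) k : U \in unitmx ->
  (forall i, k i != 0) -> root_match f g U s k ->
  root_match g f (invmx U) s^-1%g (fun i => (k (s^-1 i)%g)^-1).
Proof.
move=> uU k0 m i j; set i' := (s^-1)%g i.
have -> : i = s i' by rewrite permKV.
apply: (mulfI (k0 i')); rewrite mulr_sumr mulVKf //.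
transitivity (\sum_(l < n) \sum_(r < n)
    croot g i' ^+ (n.-1 - r) * (U r l * invmx U l j)%:~R).
  apply: eq_bigr => l _; rewrite mulrA -(m i' l) mulr_suml.
  by apply: eq_bigr => r _; rewrite intrM mulrA.
rewrite exchange_big (bigD1 j) //= [X in _ + X]big1 ?addr0 => [|r /negPf nrj].
  rewrite -mulr_sumr -rmorph_sum.
  by have /matrixP/(_ j j) := mulmxV uU; rewrite !mxE eqxx => ->; rewrite mulr1.
rewrite -mulr_sumr -rmorph_sum.
by have /matrixP/(_ r j) := mulmxV uU; rewrite !mxE nrj => ->; rewrite mulr0.
Qed.

Lemma pm_match_sym n f g (s : 'S_n) k : (forall i, k i != 0) ->
  pm_eq (lcC g ^+ n.-1 * \prod_i k i) (lcC f ^+ n.-1) ->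
  pm_eq (lcC f ^+ n.-1 * \prod_i (k (s^-1 i)%g)^-1) (lcC g ^+ n.-1).
Proof.
move=> k0 /pm_sym e; have <- : \prod_i (k i)^-1 = \prod_i (k (s^-1 i)%g)^-1.
  by rewrite [LHS](reindex_inj (@perm_inj _ s^-1%g)).
have kk : (\prod_i k i) * \prod_i (k i)^-1 = 1.
  by rewrite -big_split big1 // => i _; rewrite /= mulfV.
by have := pm_mul e (pm_refl (\prod_i (k i)^-1));
  rewrite -[in X in pm_eq _ X]mulrA kk mulr1.
Qed.

Section MatchToIso.
Variables (n : nat) (f g : {poly int}).
Hypotheses (sf : size f = n.+1) (sg : size g = n.+1) (n1 : (1 < n)%N).
Hypotheses (df : disc f != 0) (dg : disc g != 0).
Variables (U : 'M[int]_n) (s : 'S_n) (k : 'I_n -> algC).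
Hypotheses (uU : U \in unitmx) (k0 : forall i, k i != 0).
Hypothesis (m : root_match f g U s k).
Let n0 : (0 < n)%N := ltnW n1.

(** The coefficients of the form of beta after the substitution U, as elements of
    K_g; the i-th evaluation makes them proportional to the powers of the (s i)-th
    root of f. *)
Definition form_coef (j : 'I_n) : Kalg g :=
  \sum_(l < n) alpha_powers g (n.-1 - l) *~ U l j.

Lemma root_eval_form_coef i j : root_eval sg i (form_coef j) = k i * croot f (s
  i) ^+ (n.-1 - j).
Proof.
rewrite -m rmorph_sum; apply: eq_bigr => l _.
by rewrite rmorphMz rmorphXn /= root_eval_alpha mulrzr.
Qed.

Lemma form_coef_powers j : zspan n (alpha_powers g) (form_coef j).
Proof.
apply: zspan_sum => l _; apply/zspanMz/zspan_mem.
by rewrite (leq_ltn_trans (leq_subr _ _)) // ltn_predL.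
Qed.

(** The scalars k_i are the conjugates of one element of K_g, namely the last
    coefficient, since there the power of the root of f is 1. *)
Lemma match_scalar : exists2 gam : Kalg g, gam \is a GRing.unit &
  forall i, root_eval sg i gam = k i.
Proof.
have ltn1 : (n.-1 < n)%N by rewrite ltn_predL.
have E i : root_eval sg i (form_coef (Ordinal ltn1)) = k i.
  by rewrite root_eval_form_coef subnn mulr1.
by exists (form_coef (Ordinal ltn1)) => //; apply: (root_eval_unit (sf :=
  sg)) => // i; rewrite E.
Qed.

(** The quotient of the last two coefficients is the element of K_g whose conjugates
    are the roots of f in the order given by s. *)
Lemma match_lift : exists Phi : {lrmorphism Kalg f -> Kalg g},
  forall i x, root_eval sg i (Phi x) = root_eval sf (s i) x.
Proof.
have [gam ug Eg] := match_scalar.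
have ltn2 : (n.-2 < n)%N by rewrite -subn2 ltn_subrL.
pose th := form_coef (Ordinal ltn2) / gam.
have Eth i : root_eval sg i th = croot f (s i).
  rewrite /th rmorphM rmorphV //= Eg root_eval_form_coef /= mulrAC mulfV //
    mul1r.
  suff -> : (n.-1 - n.-2 = 1)%N by [].
  by case: (n) n1 => [|[|N]] //= _; rewrite subSnn.
have rth : (map_poly intr f).[th] = 0.
  apply: (root_eval_inj (sf := sg) dg n0) => i.
  by rewrite (map_poly_int_horner (root_eval sg i)) /= Eth (horner_croot sf)
    rmorph0.
have sf1 : (1 < size f)%N by rewrite sf ltnS.
exists (klift sf1 rth) => i x; apply: root_eval_lrmorphism.
by rewrite /= /klift keval_alpha.
Qed.
End MatchToIso.

Lemma zprimitive_id (p : {poly int}) : zprimitive (zprimitive p) = zprimitive p.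
Proof.
have [->|p0] := eqVneq p 0; first by rewrite !zprimitive0.
by rewrite [in RHS](zpolyEprim (zprimitive p)) zcontents_primitive p0 scale1r.
Qed.

Section TransportPowers.
Variables (n : nat) (f g : {poly int}).
Hypotheses (sf : size f = n.+1) (sg : size g = n.+1) (n1 : (1 < n)%N).
Hypotheses (df : disc f != 0) (dg : disc g != 0).
Variables (U : 'M[int]_n) (s : 'S_n) (k : 'I_n -> algC).
Hypotheses (uU : U \in unitmx) (k0 : forall i, k i != 0).
Hypothesis (m : root_match f g U s k).
Let n0 : (0 < n)%N := ltnW n1.
Variables (Phi : {lrmorphism Kalg f -> Kalg g}) (gam : Kalg g).
Hypothesis PhiE : forall i x, root_eval sg i (Phi x) = root_eval sf (s i) x.
Hypothesis Eg : forall i, root_eval sg i gam = k i.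

Lemma powers_to x : zspan n (alpha_powers f) x ->
  zspan n (alpha_powers g) (gam * Phi x).
Proof.
case=> u ->; rewrite rmorph_sum mulr_sumr; apply: zspan_sum => i _.
rewrite /= rmorphMz mulrzAr; apply: zspanMz.
suff -> : gam * Phi (alpha_powers f i) = form_coef g U (rev_ord i).
  exact: form_coef_powers.
apply: (root_eval_inj (sf := sg) dg n0) => j.
rewrite (root_eval_form_coef sg m) rmorphM /= Eg PhiE rmorphXn /=
  root_eval_alpha.
by rewrite -{1}[i]rev_ordK /= -subn1 subnAC subn1 -subnS.
Qed.

(** Together with the previous lemma: gamma Phi(M_f) = M_g. *)
Lemma powers_from y : zspan n (alpha_powers g) y ->
  exists2 x, zspan n (alpha_powers f) x & y = gam * Phi x.
Proof.
have ms := root_match_sym uU k0 m.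
case=> u ->; exists (\sum_(i < n) form_coef f (invmx U) (rev_ord i) *~ u i).
  by apply: zspan_sum => i _; apply/zspanMz/form_coef_powers.
rewrite rmorph_sum mulr_sumr; apply: eq_bigr => i _ /=.
rewrite rmorphMz mulrzAr; congr (_ *~ _).
apply: (root_eval_inj (sf := sg) dg n0) => j.
rewrite rmorphM /= Eg PhiE (root_eval_form_coef sf ms) permK mulVKf //.
rewrite rmorphXn /= root_eval_alpha.
by rewrite -{1}[i]rev_ordK /= -subn1 subnAC subn1 -subnS.
Qed.

(** The multiplier ring of M_f, which contains every x of the first span, is carried
    by Phi into that of M_g. *)
Lemma order_to (c d : int) (h h' : {poly int}) : c != 0 -> d != 0 ->
  f = c *: h -> g = d *: h' -> zprimitive h' = h' ->
  forall x, zspan n (order_gen c%:~R^-1 f) x ->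
    zspan n (order_gen d%:~R^-1 g) (Phi x).
Proof.
move=> c0 d0 fE gE h'p x xO.
have stable y : zspan n (alpha_powers g) y ->
  zspan n (alpha_powers g) (Phi x * y).
  move=> /powers_from[z zM ->]; rewrite mulrCA -rmorphM; apply: powers_to.
  exact: (order_mul_powers sf n0 c0 fE xO zM).
apply: (order_of_powers sg n0 d0 gE h'p).
  by rewrite -[Phi x]mulr1; apply: stable;
    apply: (zspan_mem (alpha_powers g)) n0.
by apply: stable; apply: (zspan_mem (alpha_powers g)); rewrite ltn_predL.
Qed.

Lemma det_powers_match :
  pm_eq ((\prod_i k i) * \det (eval_mx sf (alpha_powers f))) (\det (eval_mx sg
    (alpha_powers g))).
Proof.
have [|j|j|_ dM] := @zspan_unimodular _ _ sg (fun j =>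
  gam * Phi (alpha_powers f j)) (alpha_powers g).
- exact: det_powers_neq0.
- by apply: powers_to; apply: zspan_mem.
- have [|x [u ->] ->] := @powers_from (alpha_powers g j);
  first exact: zspan_mem.
  exists u; rewrite rmorph_sum mulr_sumr; apply: eq_bigr => i _ /=.
  by rewrite rmorphMz mulrzAr.
rewrite (det_scale sg gam (Phi \o alpha_powers f)) in dM.
apply: pm_trans dM; under [in X in pm_eq _ X]eq_bigr => i _ do rewrite Eg.
apply: pm_mul; first exact: pm_refl.
exact/pm_sym/(det_lrmorphism _ PhiE).
Qed.
End TransportPowers.

Section TransportOrder.
Variables (n : nat) (f g : {poly int}).
Hypotheses (sf : size f = n.+1) (sg : size g = n.+1) (n1 : (1 < n)%N).
Hypotheses (df : disc f != 0) (dg : disc g != 0).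
Variables (U : 'M[int]_n) (s : 'S_n) (k : 'I_n -> algC).
Hypotheses (uU : U \in unitmx).
Hypothesis (m : root_match f g U s k).
Hypothesis (e : pm_eq (lcC g ^+ n.-1 * \prod_i k i) (lcC f ^+ n.-1)).
Let n0 : (0 < n)%N := ltnW n1.
Variables (Phi : {lrmorphism Kalg f -> Kalg g}) (Psi : {lrmorphism Kalg g ->
  Kalg f}).
Hypothesis PhiE : forall i x, root_eval sg i (Phi x) = root_eval sf (s i) x.
Hypothesis PsiE : forall i x, root_eval sf i (Psi x) = root_eval sg (s^-1 i)%g
  x.

Let k0 : forall i, k i != 0 := match_neq0 (size_neq0 sf) e.

Lemma lift_cancel : cancel Phi Psi.
Proof.
by move=> x; apply: (root_eval_inj (sf := sf) df n0) => i;
  rewrite PsiE PhiE permKV.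
Qed.
Lemma lift_cancel_sym : cancel Psi Phi.
Proof.
by move=> x; apply: (root_eval_inj (sf := sg) dg n0) => i;
  rewrite PhiE PsiE permK.
Qed.

(** With c and d the contents, the multiplier rings have index (f_0 / c)^(n-1) and
    (g_0 / d)^(n-1) relative to M_f and M_g. As Phi exchanges these rings and
    f_0^(n-1) det M_f = +- g_0^(n-1) det M_g, one gets c^(n-1) = +- d^(n-1). *)
Lemma content_eq : pm_eq (zcontents f) (zcontents g).
Proof.
set c := zcontents f; set d := zcontents g.
have [f0 g0] := (size_neq0 sf, size_neq0 sg).
have [c0 d0] : c != 0 /\ d != 0 by rewrite !zcontents_eq0.
have hE := zpolyEprim f; have hE' := zpolyEprim g.
have [gam ug Eg] := match_scalar sg n1 k0 m.
have k0' i : (k (s^-1 i)%g)^-1 != 0 by rewrite invr_neq0.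
have m' := root_match_sym uU k0 m.
have [gam' ug' Eg'] := match_scalar sf n1 k0' m'.
have Vf0 := det_powers_neq0 sf df; have Vg0 := det_powers_neq0 sg dg.
have lf0 := lcC_neq0 f0; have lg0 := lcC_neq0 g0.
have [|j|j|_ dE] := @zspan_unimodular _ _ sg (Phi \o order_gen c%:~R^-1 f)
  (order_gen d%:~R^-1 g).
- rewrite det_order_gen // mulf_neq0 // expf_neq0 // mulf_neq0 //.
  by rewrite fmorph_eq0 invr_eq0 intr_eq0.
- rewrite /=; apply: (order_to n1 dg uU k0 m PhiE Eg c0 d0 hE hE'
  (zprimitive_id g)).
  exact: zspan_mem.
- rewrite -[order_gen _ g j]lift_cancel_sym; apply: zspan_map.
  have uV : invmx U \in unitmx by rewrite unitmx_inv.
  apply: (order_to n1 df uV k0' m' PsiE Eg' d0 c0 hE' hE (zprimitive_id f)).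
  exact: zspan_mem.
have {}dE := pm_trans (pm_sym (det_lrmorphism _ PhiE)) dE.
rewrite !det_order_gen // ![(ratr _ * _) ^+ _]exprMn -!mulrA in dE.
have XY : pm_eq (lcC f ^+ n.-1 * \det (eval_mx sf (alpha_powers f)))
                (lcC g ^+ n.-1 * \det (eval_mx sg (alpha_powers g))).
  apply: pm_trans (pm_mul (pm_sym e) (pm_refl _)) _.
  rewrite -mulrA; apply: pm_mul (pm_refl _) _.
  exact: (det_powers_match n1 dg uU k0 m PhiE Eg).
have {dE} : pm_eq (ratr (c%:~R^-1 : rat) ^+ n.-1 : algC) (ratr (d%:~R^-1 : rat)
  ^+ n.-1).
  apply: (@pm_mulI _ (lcC f ^+ n.-1 * \det (eval_mx sf (alpha_powers f)))).
    by rewrite mulf_neq0 ?expf_neq0.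
  rewrite ![(_ * \det _) * _]mulrC; apply: pm_trans dE _.
  by apply: pm_mul (pm_refl _) (pm_sym XY).
have rV (a : int) : ratr (a%:~R^-1 : rat) = a%:~R^-1 :> algC.
  by rewrite fmorphV /= ratr_int.
rewrite !rV => cd.
have {cd} : `|c%:~R^-1 : algC| ^+ n.-1 = `|d%:~R^-1 : algC| ^+ n.-1.
  by rewrite -!normrX; case: cd => ->; rewrite ?normrN.
move=> /eqP; rewrite eqrXn2 ?normr_ge0 // -?subn1 ?subn_gt0 // !normfV =>
  /eqP/invr_inj.
rewrite -!intr_norm => /intr_inj/eqP; rewrite eqr_norm2.
by case/orP => /eqP ->; [left | right].
Qed.
End TransportOrder.

Lemma order_gen_content n g (d : int) y : size g = n.+1 -> (0 < n)%N ->
  d != 0 ->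
  zspan n (order_gen d%:~R^-1 g) y -> y *~ d \in in_order g.
Proof.
move=> sg n0 d0 [u ->]; apply/(in_order_zspan _ sg n0).
rewrite mulrz_suml; apply: zspan_sum => i _; rewrite mulrzAC; apply: zspanMz.
case: i => -[|i] lti /=; first by apply/zspanMz;
  exact: (zspan_mem (order_gen 1 g) lti).
rewrite -scaler_int scalerA mulfV ?intr_eq0 //.
exact: (zspan_mem (order_gen 1 g) lti).
Qed.

(** R_f = Z + c E_f with E_f the multiplier ring of M_f, and both Phi(E_f) = E_g and
    the content are preserved. *)
Lemma order_map n f g (sf : size f = n.+1) (sg : size g = n.+1) U (s : 'S_n) k
    (Phi : {lrmorphism Kalg f -> Kalg g}) (Psi : {lrmorphism Kalg g ->
      Kalg f}) :
  (1 < n)%N -> disc f != 0 -> disc g != 0 ->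
  U \in unitmx -> root_match f g U s k ->
  pm_eq (lcC g ^+ n.-1 * \prod_i k i) (lcC f ^+ n.-1) ->
  (forall i x, root_eval sg i (Phi x) = root_eval sf (s i) x) ->
  (forall i x, root_eval sf i (Psi x) = root_eval sg (s^-1 i)%g x) ->
  forall x, x \in in_order f -> Phi x \in in_order g.
Proof.
move=> n1 df dg uU m e PhiE PsiE x; have n0 := ltnW n1.
have cd := content_eq n1 df dg uU m e PhiE PsiE.
have [f0 g0] := (size_neq0 sf, size_neq0 sg).
have [c0 d0] : zcontents f != 0 /\ zcontents g != 0 by rewrite !zcontents_eq0.
have k0 := match_neq0 f0 e.
have [gam ug Eg] := match_scalar sg n1 k0 m.
have to := order_to n1 dg uU k0 m PhiE Eg c0 d0 (zpolyEprim f) (zpolyEprim g)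
  (zprimitive_id g).
move=> /(in_order_zspan _ sf n0)[u ->]; rewrite rmorph_sum rpred_sum // =>
  i _ /=.
rewrite rmorphMz rpredMz //; case: i => -[|i] lti /=.
  by rewrite rmorph1 rpred1.
rewrite -[1](mulVf (_ : (zcontents f)%:~R != 0 :> rat)) ?intr_eq0 //.
rewrite mulrC -scalerA scaler_int rmorphMz /=.
have Oi : Phi ((zcontents f)%:~R^-1 *: omega f i.+1) *~ zcontents g \in
  in_order g.
  by apply: (order_gen_content sg n0 d0); apply: to;
    apply: (zspan_mem (order_gen _ f) lti).
move: (Phi _) Oi => y Oi.
by case: cd => ->; rewrite ?mulrNz ?rpredN.
Qed.

Section Restriction.
Variables (f g : {poly int}) (Phi : {lrmorphism Kalg f -> Kalg g}).
Hypothesis Phi_order : forall x, x \in in_order f -> Phi x \in in_order g.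
Definition order_restr (x : invariant_order f) : invariant_order g :=
  InvariantOrder (Phi_order (valP x)).
Fact order_restr_zmod : zmod_morphism order_restr.
Proof. by move=> x y; apply/val_inj; rewrite /= rmorphB. Qed.
HB.instance Definition _ := GRing.isZmodMorphism.Build _ _ order_restr
  order_restr_zmod.
Fact order_restr_monoid : monoid_morphism order_restr.
Proof. by split=> [|x y]; apply/val_inj; rewrite /= ?rmorph1 ?rmorphM. Qed.
HB.instance Definition _ := GRing.isMonoidMorphism.Build _ _ order_restr
  order_restr_monoid.
End Restriction.

(** * The two directions of the equivalence, and the monic case *)

Lemma iso_of_hermite n f g : (1 < n)%N ->
  size f = n.+1 -> size g = n.+1 -> disc f != 0 -> disc g != 0 ->
  hermite_equiv n f g ->
  exists2 phi : {rmorphism invariant_order f -> invariant_order g},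
    bijective phi &
    same_ideal_class phi (ideal_exp (invariant_ideal f) n.-1)
                         (ideal_exp (invariant_ideal g) n.-1).
Proof.
move=> n1 sf sg df dg; have n0 := ltnW n1; have [f0 g0] :=
  (size_neq0 sf, size_neq0 sg).
case/(match_of_hermite sf sg df dg) => U [s [k [uU m e]]].
have k0 := match_neq0 f0 e.
have e' := pm_match_sym s k0 e; have m' := root_match_sym uU k0 m.
have uV : invmx U \in unitmx by rewrite unitmx_inv.
have k0' := match_neq0 g0 e'.
have [Phi PhiE] := match_lift sf sg n1 dg k0 m.
have [Psi PsiE] := match_lift sg sf n1 df k0' m'.
have PhiE' i x : root_eval sg i (Phi x) = root_eval sf ((s^-1)^-1 i)%g x by
  rewrite invgK.
have PhiO := order_map n1 df dg uU m e PhiE PsiE.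
have PsiO := order_map n1 dg df uV m' e' PsiE PhiE'.
have phiK := lift_cancel n1 df PhiE PsiE; have psiK :=
  lift_cancel_sym n1 dg PhiE PsiE.
have [gam ug Eg] := match_scalar sg n1 k0 m.
exists (order_restr PhiO : {rmorphism _ -> _}).
  by exists (order_restr PsiO) => x; apply/val_inj; rewrite /= ?phiK ?psiK.
exists Phi; split=> //; first by exists Psi.
exists gam^-1; rewrite ?unitrV // => y; split.
  case=> x /(ideal_expE sf n1)/(powers_to n1 dg m PhiE Eg) Mx ->.
  by exists (gam * Phi x); rewrite ?mulKr //; apply/(ideal_expE sg n1).
case=> z /(ideal_expE sg n1)/(powers_from n1 dg uU k0 m PhiE Eg)[x Mx ->] ->.
by exists x; rewrite ?mulKr //; apply/(ideal_expE sf n1).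
Qed.

Lemma hermite_of_same_class n f g
    (phi : {rmorphism invariant_order f -> invariant_order g}) : (1 < n)%N ->
  size f = n.+1 -> size g = n.+1 -> disc f != 0 -> disc g != 0 ->
  bijective phi ->
  same_ideal_class phi (ideal_exp (invariant_ideal f) n.-1)
                       (ideal_exp (invariant_ideal g) n.-1) ->
  hermite_equiv n f g.
Proof.
move=> n1 sf sg df dg [psi phiK psiK] [Phi [Phi_bij PhiE [kap uk HK]]].
apply: (hermite_of_iso sf sg dg n1 Phi_bij uk).
- by move=> x Ox; have /= -> := PhiE (InvariantOrder Ox); apply: valP.
- move=> y Oy; exists (\val (psi (InvariantOrder Oy))); first exact: valP.
  by rewrite PhiE psiK.
move=> y; split=> [[x Mx ->]|[z Mz ->]].
  have [|z /(ideal_expE sg n1) Mz ->] := (HK (Phi x)).1; last by exists z.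
  by exists x => //; apply/(ideal_expE sf n1).
have [|x /(ideal_expE sf n1) Mx ->] := (HK (kap * z)).2; last by exists x.
by exists z => //; apply/(ideal_expE sg n1).
Qed.

Section Monic.
Variables (n : nat) (f : {poly int}).
Hypotheses (sf : size f = n.+1) (n1 : (1 < n)%N) (mf : f \is monic).

Lemma alpha_in_order : alpha f \in in_order f.
Proof.
have := in_order_omega (_ : 0 < (deg f).-1)%N.
rewrite /deg sf /= -subn1 subn_gt0 => /(_ n1).
rewrite omegaS /omega big_ord0 add0r /dcoef subn0 -[f`_ _]/(lead_coef f).
by rewrite (monicP mf) mulr1.
Qed.

Lemma in_order_monic x : x \in in_order f <-> zspan n (alpha_powers f) x.
Proof.
split=> [Ox|[u ->]]; last first.
  by apply: rpred_sum => i _; apply/rpredMz/rpredX/alpha_in_order.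
rewrite -[x]mulr1; apply: (in_order_mul_powers sf n1 Ox).
exact: (zspan_mem (alpha_powers f) (ltnW n1)).
Qed.

(** For monic f the order is Z[alpha], so phi is determined by the root phi(alpha) of
    f, which also defines the morphism on K_f. *)
Lemma monic_extend g (phi : {rmorphism invariant_order f ->
  invariant_order g}) :
  exists Phi : {lrmorphism Kalg f -> Kalg g},
    forall x : invariant_order f, Phi (\val x) = \val (phi x).
Proof.
pose a := InvariantOrder alpha_in_order.
have sf1 : (1 < size f)%N by rewrite sf ltnS ltnW.
have ra : (map_poly intr f).[a] = 0.
  apply/val_inj; rewrite (map_poly_int_horner (\val : {rmorphism _ -> Kalg f})).
  by rewrite (horner_alpha0 sf sf1).
have rth : (map_poly intr f).[\val (phi a)] = 0.
  rewrite -(map_poly_int_horner (\val : {rmorphism _ -> Kalg g})).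
  by rewrite -(map_poly_int_horner phi) ra !rmorph0.
exists (klift sf1 rth) => x.
have [u Dx] := (in_order_monic (\val x)).1 (valP x).
have -> : x = \sum_(i < n) a ^+ i *~ u i.
  apply/val_inj; rewrite Dx rmorph_sum; apply: eq_bigr => i _.
  by rewrite rmorphMz rmorphXn.
rewrite !rmorph_sum; apply: eq_bigr => i _.
rewrite !rmorphMz !rmorphXn; congr (_ ^+ _ *~ _); exact: keval_alpha.
Qed.
End Monic.

Lemma lrmorphism_id n f (F : {lrmorphism Kalg f -> Kalg f}) :
  size f = n.+1 -> (0 < n)%N -> disc f != 0 ->
  F (alpha f) = alpha f -> forall x, F x = x.
Proof.
move=> sf n0 df Fa x; apply: (root_eval_inj (sf := sf) df n0) => i.
by apply: root_eval_lrmorphism; rewrite Fa root_eval_alpha.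
Qed.

(** For monic f and g, M_f = R_f and M_g = R_g, so kappa = 1 works. *)
Lemma monic_same_class n f g
    (phi : {rmorphism invariant_order f -> invariant_order g}) : (1 < n)%N ->
  size f = n.+1 -> size g = n.+1 -> f \is monic -> g \is monic ->
  disc f != 0 -> disc g != 0 -> bijective phi ->
  same_ideal_class phi (ideal_exp (invariant_ideal f) n.-1)
                       (ideal_exp (invariant_ideal g) n.-1).
Proof.
move=> n1 sf sg mf mg df dg [psi phiK psiK]; have n0 := ltnW n1.
pose psiZ := GRing.isZmodMorphism.Build _ _ psi (can2_zmod_morphism phiK psiK).
pose psiM := GRing.isMonoidMorphism.Build _ _ psi (can2_monoid_morphism phiK
  psiK).
pose psiR : {rmorphism invariant_order g -> invariant_order f} :=
  HB.pack psi psiZ psiM.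
have [Phi PhiE] := monic_extend sf n1 mf phi.
have [Psi PsiE] := monic_extend sg n1 mg psiR.
exists Phi; split=> //.
  pose a := InvariantOrder (alpha_in_order sf n1 mf).
  pose b := InvariantOrder (alpha_in_order sg n1 mg).
  exists Psi => x.
    apply: (lrmorphism_id (F := Psi \o Phi) sf n0 df) => /=.
    by rewrite (PhiE a) PsiE /= phiK.
  apply: (lrmorphism_id (F := Phi \o Psi) sg n0 dg) => /=.
  by rewrite (PsiE b) PhiE /= psiK.
exists 1; first exact: unitr1.
move=> y; split=> [[x Mx ->]|[z Mz ->]].
  exists (Phi x); rewrite ?mul1r //; apply/(ideal_expE sg n1)/(in_order_monic
    sg n1 mg).
  have Ox : x \in in_order f by apply/(in_order_monic sf n1 mf)/(ideal_expE sf
    n1).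
  by have /= -> := PhiE (InvariantOrder Ox); apply: valP.
have Oz : z \in in_order g by apply/(in_order_monic sg n1 mg)/(ideal_expE sg
  n1).
exists (\val (psi (InvariantOrder Oz))); last by rewrite mul1r PhiE psiK.
by apply/(ideal_expE sf n1)/(in_order_monic sf n1 mf); apply: valP.
Qed.

(** * GL_2(Z)-equivalence *)

Lemma homogenize (L : fieldType) (p : {poly L}) m (N D : L) : D != 0 ->
  (size p <= m.+1)%N ->
  D ^+ m * p.[N / D] = \sum_(i < m.+1) p`_i * N ^+ i * D ^+ (m - i).
Proof.
move=> D0 sp; rewrite (horner_coef_wide _ sp) mulr_sumr; apply: eq_bigr => i _.
have lei : (i <= m)%N by rewrite -ltnS.
rewrite -{1}(subnK lei) exprD expr_div_n mulrCA -!mulrA; congr (_ * _).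
by rewrite [D ^+ i * _]mulrC divfK ?expf_neq0 // mulrC.
Qed.

Definition numer (A : 'M[int]_2) : {poly int} := A 0 0 *: 'X + (A 0 1)%:P.
Definition denom (A : 'M[int]_2) : {poly int} := A 1 0 *: 'X + (A 1 1)%:P.

Lemma det2 (R : comPzRingType) (A : 'M[R]_2) : \det A = A 0 0 * A 1 1 - A 0 1 *
  A 1 0.
Proof.
rewrite (expand_det_row _ 0) !big_ord_recl big_ord0 addr0 /cofactor !det_mx11
  !mxE /=.
rewrite expr0 mul1r expr1 mulN1r mulrN.
have -> : lift 0 0 = 1 :> 'I_2 by apply/val_inj.
by have -> : lift 1 0 = 0 :> 'I_2 by apply/val_inj.
Qed.

Lemma denom_neq0 (A : 'M[int]_2) : A \in unitmx -> denom A != 0.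
Proof.
apply: contraTneq => /polyP D0; have := D0 0%N; have := D0 1%N.
rewrite /denom !coefD !coefZ !coefC !coefX /= !addr0 mulr0 add0r mulr1.
by move=> A10 A11; rewrite unitmxE det2 A10 A11 !mulr0 subr0.
Qed.

(** The form of degree n attached to f, at the two linear forms of A: the Moebius
    transform of f, cleared of its denominator. *)
Definition hompoly n (A : 'M[int]_2) (f : {poly int}) : {poly int} :=
  \sum_(i < n.+1) f`_i *: (numer A ^+ i * denom A ^+ (n - i)).

Lemma moebiusE n A f : A \in unitmx -> size f = n.+1 ->
  moebius n A f = tofrac (hompoly n A f).
Proof.
move=> uA sf; rewrite /moebius -/(numer A) -/(denom A).
rewrite homogenize ?tofrac_eq0 ?denom_neq0 //; last first.
  by rewrite (leq_trans (size_poly _ _)) // sf.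
rewrite rmorph_sum; apply: eq_bigr => i _ /=.
rewrite coef_map -mulrA -mul_polyC !rmorphM !rmorphXn /=; congr (_ * _).
by rewrite -[X in tofrac X%:P]intz !rmorph_int.
Qed.

Lemma map_intr_inj : injective (fun p : {poly int} => cpoly p).
Proof. by apply: map_inj_poly => //; apply: intr_inj. Qed.

(** Computed in the fraction field, where f splits and each factor N / D - a absorbs
    one factor D of D^n. *)
Lemma map_hompoly n A f : A \in unitmx -> size f = n.+1 ->
  cpoly (hompoly n A f) =
  lcC f *: \prod_(a <- croots f) (cpoly (numer A) - a *: cpoly (denom A)).
Proof.
move=> uA sf.
pose L := {fraction {poly algC}}.
pose io : {rmorphism algC -> L} := @tofrac {poly algC} \o polyC.
pose N : L := tofrac (cpoly (numer A)); pose D : L := tofrac (cpoly (denom A)).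
have D0 : D != 0.
  rewrite tofrac_eq0; apply: contraNneq (denom_neq0 uA) => D0.
  by apply/eqP/map_intr_inj; rewrite D0 rmorph0.
apply/eqP; rewrite -tofrac_eq; apply/eqP.
transitivity (D ^+ n * (map_poly io (cpoly f)).[N / D]).
  rewrite homogenize //; last first.
    by rewrite size_map_poly (leq_trans (size_poly _ _)) // sf.
  rewrite !rmorph_sum; apply: eq_bigr => i _ /=.
  rewrite !coef_map map_polyZ -mul_polyC !rmorphM !rmorphXn /= mulrA.
  by rewrite -/N -/D.
rewrite croots_prod map_polyZ rmorph_prod hornerZ horner_prod.
rewrite -mul_polyC rmorphM mulrCA; congr (_ * _).
rewrite -(size_croots sf); elim: (croots f) => [|a r IH].
  by rewrite !big_nil mulr1 rmorph1.
rewrite !big_cons rmorphM /= -IH exprS map_polyXsubC hornerXsubC.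
have -> : tofrac (cpoly (numer A) - a *: cpoly (denom A)) = D * (N / D - io a).
  by rewrite mulrBr [D * (N / D)]mulrC divfK // rmorphB -mul_polyC rmorphM
    mulrC.
by rewrite -!mulrA; congr (_ * _); rewrite mulrCA.
Qed.

(** The coefficients u z may vanish, so the top degree is only a bound on the size. *)
Lemma prod_linear_top (R : comNzRingType) (I : Type) (r : seq I) (u v : I ->
  R) :
  (size (\prod_(z <- r) (u z *: 'X + (v z)%:P))%R <= (size r).+1)%N /\
  (\prod_(z <- r) (u z *: 'X + (v z)%:P))`_(size r) = \prod_(z <- r) u z.
Proof.
elim: r => [|a r [sP cP]]; first by rewrite !big_nil size_poly1 coef1.
rewrite !big_cons; set P := \prod_(z <- r) _ in sP cP *.
have -> : (u a *: 'X + (v a)%:P) * P = u a *: ('X * P) + v a *: P.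
  by rewrite mulrDl -scalerAl mul_polyC.
split; last first.
  by rewrite coefD !coefZ coefXM /= cP [P`_(size r).+1]nth_default ?mulr0
    ?addr0.
rewrite (leq_trans (size_polyD _ _)) // geq_max.
rewrite !(leq_trans (size_scale_leq _ _)) ?(leq_trans sP) //.
by rewrite mulrC (leq_trans (size_polyMleq _ _)) // size_polyX addn2.
Qed.

(** The (n-1)-st symmetric power of A. *)
Definition sympow_mx n (A : 'M[int]_2) : 'M[int]_n :=
  \matrix_(i, k) (numer A ^+ (n.-1 - k) * denom A ^+ k)`_(n.-1 - i).

Lemma size_linear (a b : int) : (size (a *: 'X + b%:P)%R <= 2)%N.
Proof.
rewrite (leq_trans (size_polyD _ _)) // geq_max (leq_trans (size_scale_leq _
  _)) ?size_polyX //.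
by rewrite (leq_trans (size_polyC_leq1 _)).
Qed.

Lemma size_exp_linear (a b : int) m : (size ((a *: 'X + b%:P) ^+ m)%R <=
  m.+1)%N.
Proof.
rewrite (leq_trans (size_poly_exp_leq _ _)) // ltnS -{2}[m]mul1n leq_mul2r.
by rewrite -subn1 leq_subLR size_linear orbT.
Qed.

Lemma size_sympow n (A : 'M[int]_2) (k : 'I_n) :
  (size (numer A ^+ (n.-1 - k) * denom A ^+ k)%R <= n)%N.
Proof.
rewrite (leq_trans (size_polyMleq _ _)) // -ltnS.
have n0 : (0 < n)%N by apply: leq_ltn_trans (ltn_ord k).
have lek : (k <= n.-1)%N by rewrite -ltnS prednK.
have := leq_add (size_exp_linear (A 0 0) (A 0 1) (n.-1 - k)) (size_exp_linear
  (A 1 0) (A 1 1) k).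
rewrite addSn addnS subnK // prednK //.
by case: (_ + _)%N.
Qed.

Lemma sympow_mx_horner (R : comNzRingType) n (A : 'M[int]_2) (x : R) (k : 'I_n)
  :
  \sum_(i < n) x ^+ (n.-1 - i) * (sympow_mx n A i k)%:~R =
  (map_poly intr (numer A)).[x] ^+ (n.-1 - k) * (map_poly intr (denom A)).[x]
    ^+ k.
Proof.
rewrite -!horner_exp -hornerM -!rmorphXn -rmorphM /=.
rewrite (@horner_coef_wide _ n); last by rewrite (leq_trans (size_poly _ _)) //
  size_sympow.
rewrite (reindex_inj rev_ord_inj) /=; apply: eq_bigr => i _.
rewrite coef_map mxE mulrC /=.
have -> : (n.-1 - (n - i.+1) = i)%N by rewrite -subn1 -subnDA add1n subnSK //
  subKn // ltnW.
by [].
Qed.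

(** Symmetric powers are multiplicative: substituting the linear forms of A in those
    of its inverse gives back X and 1. *)
Lemma sympow_mx_unit n (A : 'M[int]_2) : A \in unitmx ->
  sympow_mx n A \in unitmx.
Proof.
move=> uA; pose B := invmx A.
suff : sympow_mx n A *m sympow_mx n B = 1%:M by case/mulmx1_unit.
pose D := tofrac (denom A); pose N := tofrac (numer A).
have D0 : D != 0 by rewrite tofrac_eq0 denom_neq0.
have BA i : D * (map_poly intr (B i 0 *: 'X + (B i 1)%:P)).[N / D] =
    tofrac ((i == 0)%:R *: 'X + (i == 1)%:R%:P).
  have /matrixP BA1 : B *m A = 1%:M by rewrite mulVmx.
  have := BA1 i 0; have := BA1 i 1; rewrite !mxE !big_ord_recl !big_ord0 !addr0.
  have -> : lift 0 0 = 1 :> 'I_2 by apply/val_inj.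
  move=> e1 e0; rewrite -[(i == 0)%:R]e0 -[(i == 1)%:R]e1.
  rewrite rmorphD /= map_polyZ map_polyX map_polyC hornerD hornerZ hornerX
    hornerC /=.
  rewrite mulrDr mulrCA [D * (N / D)]mulrC divfK // mulrC.
  have iT (a : int) : a%:~R = tofrac a%:P by rewrite -[X in tofrac X%:P]intz
    !rmorph_int.
  rewrite !iT [D * _]mulrC /N /D -!rmorphM -!rmorphD /=; congr tofrac.
  rewrite /numer /denom -!mul_polyC; ring.
have P (k : 'I_n) : \sum_(j < n) sympow_mx n B j k *: (numer A ^+ (n.-1 - j) *
  denom A ^+ j) = 'X^(n.-1 - k).
  apply/eqP; rewrite -tofrac_eq; apply/eqP.
  transitivity (D ^+ n.-1 * (\sum_(j < n) (N / D) ^+ (n.-1 - j) * (sympow_mx n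
    B j k)%:~R)).
    rewrite rmorph_sum mulr_sumr; apply: eq_bigr => j _ /=.
    have lej : (j <= n.-1)%N by rewrite -ltnS prednK // (leq_ltn_trans _
      (ltn_ord j)).
    rewrite -mul_polyC -[X in X%:P]intz !rmorphM !rmorphXn /= !rmorph_int
      [RHS]mulrA [RHS]mulrC; congr (_ * _).
    rewrite -[X in D ^+ X](subnK lej) exprD mulrAC expr_div_n; congr (_ * _).
    by rewrite mulrC divfK ?expf_neq0.
  have lek : (k <= n.-1)%N by rewrite -ltnS prednK // (leq_ltn_trans _ (ltn_ord
    k)).
  rewrite sympow_mx_horner -[X in D ^+ X](subnK lek) exprD mulrACA -!exprMn.
  rewrite (BA 0) (BA 1) /= scale0r scale1r addr0 add0r rmorph1 expr1n mulr1.
  by rewrite -rmorphXn.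
apply/matrixP => i k; have /polyP/(_ (n.-1 - i)%N) := P k.
rewrite coef_sum coefXn !mxE => {P} Ek.
transitivity (((n.-1 - i)%N == (n.-1 - k)%N)%:R : int).
  by rewrite -Ek; apply: eq_bigr => j _; rewrite coefZ mulrC !mxE.
suff -> : ((n.-1 - i)%N == (n.-1 - k)%N) = (i == k) by [].
apply/eqP/eqP => [E|->//]; apply/val_inj.
have le (l : 'I_n) : (l <= n.-1)%N by rewrite -ltnS prednK // (leq_ltn_trans _
  (ltn_ord l)).
by rewrite /= -(subKn (le i)) E subKn.
Qed.

(** The roots of g are b = - (A01 - a A11) / (A00 - a A10) for the roots a of f,
    and (A10 b + A11) (A00 - a A10) = det A = +-1; the scalars are
    (A10 b + A11)^(n-1). *)
Lemma hermite_of_GL2 n f g : size f = n.+1 -> size g = n.+1 ->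
  GL2_equiv n f g -> hermite_equiv n f g.
Proof.
move=> sf sg [A uA HA].
have [f0 g0] := (size_neq0 sf, size_neq0 sg).
have {HA} [e e1 gE] : exists2 e : algC, pm_eq e 1 & cpoly g = e *: cpoly
  (hompoly n A f).
  rewrite moebiusE // in HA; case: HA => [/eqP|/eqP].
    by rewrite tofrac_eq => /eqP->; exists 1; rewrite ?scale1r; [left|].
  rewrite -rmorphN tofrac_eq => /eqP->; exists (-1); first by right.
  by rewrite rmorphN scaleN1r.
pose u a : algC := (A 0 0)%:~R - a * (A 1 0)%:~R.
pose v a : algC := (A 0 1)%:~R - a * (A 1 1)%:~R.
pose beta a := - v a / u a.
have lin a : cpoly (numer A) - a *: cpoly (denom A) = u a *: 'X + (v a)%:P.
  rewrite /numer /denom !rmorphD /= !map_polyZ /= !map_polyX !map_polyC /= /u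
    /v.
  by rewrite -!mul_polyC !rmorphB !rmorphM /=; ring.
rewrite (map_hompoly uA sf) scalerA in gE.
rewrite (eq_bigr _ (fun a _ => lin a)) in gE.
have sr := size_croots sf; set P := \prod_(a <- _) _ in gE.
have [_ ] := prod_linear_top (croots f) u v; rewrite -/P sr => top.
(* As g has degree n, no factor loses its leading coefficient. *)
have lg : lcC g = e * lcC f * \prod_(a <- croots f) u a.
  have := congr1 (fun p : {poly algC} => p`_n) gE; rewrite coef_map coefZ top.
  by rewrite /lcC [lead_coef g]lead_coefE sg.
have lg0 := lcC_neq0 g0; have lf0 := lcC_neq0 f0.
have u0 a : a \in croots f -> u a != 0.
  move=> ra; move: lg0; rewrite lg mulf_eq0 => /norP[_].
  by rewrite prodf_seq_neq0 => /allP/(_ a ra).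
have Dg : \prod_(z <- croots g) ('X - z%:P) = \prod_(a <- croots f) ('X - (beta
  a)%:P).
  apply: (scalerI lg0); rewrite -croots_prod gE lg -[RHS]scalerA -scaler_prod.
  congr (_ *: _); rewrite /P big_seq [RHS]big_seq; apply: eq_bigr => a ra.
  rewrite scalerBr; have -> : u a *: (beta a)%:P = - (v a)%:P.
    by rewrite -mul_polyC -polyCM mulrC divfK ?u0 // polyCN.
  by rewrite opprK.
have gf : perm_eq (croots g) [seq beta a | a <- croots f].
  by apply: prod_XsubC_eq; rewrite big_map.
pose del a := (A 1 0)%:~R * beta a + (A 1 1)%:~R : algC.
pose d : algC := (\det A)%:~R.
have delE a : a \in croots f -> u a * del a = d.
  move=> /u0 ua0; rewrite /del mulrDr mulrCA /beta [u a * (_ / _)]mulrC divfK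
    //.
  by rewrite /d det2 rmorphB !rmorphM /u /v /=; ring.
have numE a : a \in croots f -> (A 0 0)%:~R * beta a + (A 0 1)%:~R = a * del a.
  move=> /u0 ua0; apply: (mulfI ua0); rewrite /del.
  have ub : u a * beta a = - v a by rewrite /beta mulrC divfK.
  by rewrite [LHS]mulrDr mulrCA ub [RHS]mulrCA [u a * (_ + _)]mulrDr [u a * (_
    * beta a)]mulrCA ub /u /v; ring.
exists (sympow_mx n A); first exact: sympow_mx_unit.
rewrite !hermite_formE linear_subst_prod (perm_big _ gf) big_map /=.
have sub a : a \in croots f ->
    linear_subst (sympow_mx n A) (root_form n (beta a)) = del a ^+ n.-1 *:
      root_form n a.
  move=> ra; apply: linear_subst_root_form => j; rewrite sympow_mx_horner.
  have lej : (j <= n.-1)%N by rewrite -ltnS prednK // (leq_ltn_trans _ (ltn_ord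
    j)).
  rewrite /numer /denom !rmorphD /= !map_polyZ /= !map_polyX !map_polyC /=.
  rewrite !hornerD !hornerZ !hornerX !hornerC /= numE // -/(del a) exprMn
    -mulrA -exprD subnK // mulrC.
  by [].
rewrite big_seq (eq_bigr _ sub) -big_seq scaler_prod scalerA prodrXl -exprMn.
have -> : lcC g * \prod_(a <- croots f) del a = lcC f * (e * d ^+ n).
  rewrite lg -mulrA -big_split /= big_seq (eq_bigr _ delE) -big_seq.
  by rewrite big_const_seq count_predT sr iter_mulr_1; ring.
have dpm : pm_eq d 1.
  rewrite /d; have /orP[/eqP->|/eqP->] : (\det A == 1) || (\det A == -1) := uA.
    by left.
  by right; rewrite rmorphN1.
have pmX x m : pm_eq x (1 : algC) -> pm_eq (x ^+ m) 1.
  move=> x1; elim: m => [|m IH]; first by left.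
  by rewrite exprS -[X in pm_eq _ X]mulr1; apply: pm_mul.
have : pm_eq (e * d ^+ n) 1 by rewrite -[X in pm_eq _ X]mulr1;
  apply: pm_mul => //; apply: pmX.
move=> /(pmX _ n.-1) E; rewrite [(lcC f * _) ^+ _]exprMn.
by case: E=> ->; [left; rewrite mulr1 | right; rewrite mulrN1 scaleNr].
Qed.

Lemma GL2_of_Z n f g : Z_equiv n f g -> GL2_equiv n f g.
Proof.
case=> eps [a [eps1 ->]].
pose A : 'M[int]_2 := \matrix_(i, j) if i == 0 then (if j == 0 then eps else a)
   else (if j == 0 then 0 else 1).
have uA : A \in unitmx.
  rewrite unitmxE det2 !mxE /= mulr1 mulr0 subr0.
  by case: eps1 => ->; rewrite ?unitrN unitr1.
exists A => //; rewrite /moebius !mxE /= scale0r add0r rmorph1 expr1n mul1r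
  divr1.
rewrite -(map_poly_int_horner (@tofrac {poly int})).
have -> : (map_poly intr f).[eps *: 'X + a%:P] = f \Po (eps *: 'X + a%:P).
  by congr (_.[_]); apply: eq_map_poly => b;
    rewrite -[in RHS](intz b) rmorph_int.
have [->|->] : eps ^+ n = 1 \/ eps ^+ n = -1.
    case: eps1 => ->; first by left; rewrite expr1n.
    by rewrite -signr_odd; case: (odd n); [right | left].
  by left; rewrite scale1r.
by right; rewrite scaleN1r rmorphN.
Qed.

Unset Implicit Arguments.

Theorem theorem1p2 (n : nat) (n_ge2 : (2 <= n)%N) :
  (forall f g : {poly int},
     size f = n.+1 -> size g = n.+1 -> disc f != 0 -> disc g != 0 ->
     hermite_equiv n f g <->
     exists2 phi : {rmorphism invariant_order f -> invariant_order g},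
       bijective phi &
       same_ideal_class phi (ideal_exp (invariant_ideal f) n.-1)
                            (ideal_exp (invariant_ideal g) n.-1))
  /\
  (forall f g : {poly int},
     size f = n.+1 -> size g = n.+1 -> f \is monic -> g \is monic ->
     disc f != 0 -> disc g != 0 ->
     hermite_equiv n f g <->
     exists phi : {rmorphism invariant_order f -> invariant_order g},
       bijective phi)
  /\
  ((forall f g : {poly int},
      size f = n.+1 -> size g = n.+1 ->
      GL2_equiv n f g -> hermite_equiv n f g)
   /\
   (forall f g : {poly int},
      size f = n.+1 -> size g = n.+1 -> f \is monic -> g \is monic ->
      Z_equiv n f g -> hermite_equiv n f g)).
Proof.
split=> [f g sf sg df dg|].
  split=> [|[phi phi_bij]]; first exact: iso_of_hermite.
  exact: hermite_of_same_class.
split=> [f g sf sg mf mg df dg|].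
  split=> [/(iso_of_hermite n_ge2 sf sg df dg)[phi phi_bij _]|[phi phi_bij]].
    by exists phi.
  apply: (hermite_of_same_class (phi := phi)) => //.
  exact: monic_same_class.
split=> f g sf sg; first exact: hermite_of_GL2.
by move=> _ _ /GL2_of_Z; apply: hermite_of_GL2.
Qed.
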